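(* The map $\Phi:(\widehat{\mathcal{H}},\sqcup,\Delta)\to(\mathfrak{l}^\infty,\mu,\delta)$ is an isomorphism of bialgebras.
   Context: $\mathbb{K}$ is a field of characteristic zero. Graphs: a graph $\Gamma$ is a finite set of half-edges with a partition $E(\Gamma)$ into 2-element sets (edges), a partition $V(\Gamma)$ (vertices), and a subset $V_{\mathrm{ext}}(\Gamma)$ of the 1-valent vertices (external vertices); the others are internal. Isomorphisms preserve all data; $\mathrm{Aut}(\Gamma)$. $\mathcal{H}$ has basis the isomorphism classes of graphs, $\mathcal{H}_n$ is spanned by graphs with $n$ edges, $\widehat{\mathcal{H}}=\prod_n\mathcal{H}_n$ with commutative product $\sqcup$ (disjoint union, extended continuously). With $\langle\Gamma_1,\Gamma_2\rangle=1$ if $\Gamma_1\cong\Gamma_2$ and $0$ otherwise, $I:\widehat{\mathcal{H}}\to\mathcal{H}^*$, $I(\Gamma)=|\mathrm{Aut}(\Gamma)|\langle\Gamma,-\rangle$, and $\Delta:\widehat{\mathcal{H}}\to\widehat{\mathcal{H}}\hat\otimes\widehat{\mathcal{H}}$ is defined by $(I\hat\otimes I)\circ\Delta=\sqcup^*\circ I$ (equivalently, $\Delta$ is the cocommutative coproduct of $\widehat{\mathcal{H}}\cong\widehat{S}(\widehat{\mathcal{H}}_c)$ for which connected graphs are primitive). Tensors: for $n\ge1$, $V_n=\mathbb{K}^n$ with basis $x_1,\dots,x_n$ and form $\langle x_i,x_j\rangle=\delta_{ij}$; $O(n)$ its orthogonal group; $x_1^*,\dots,x_n^*$ the dual basis,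 and the inverse form on $V_n^*$ is $\langle x_i^*,x_j^*\rangle^{-1}=\delta_{ij}$. For such $V$, $\widehat{\mathfrak{h}}[V]=\prod_{d\ge0}S^d(V^* )$ (formal power series), $\widehat{\mathfrak{h}}_{\ge1}[V]=\prod_{d\ge1}S^d(V^* )$, $\mathfrak{h}[V]=S(V^* )$, $\widehat{S}(W)=\prod_dW^{\hat\otimes d}/\mathbb{S}_d$, and $\mathfrak{l}[V]=\big[\widehat{S}(\widehat{\mathfrak{h}}_{\ge1}[V])\hat\otimes\widehat{\mathfrak{h}}[V]\big]^{O(V)}$. Put $\mathfrak{l}^n=\mathfrak{l}[V_n]$; restriction along $V_n\to V_{n+1}$, $x_i\mapsto x_i$ (i.e. $V_{n+1}^*\to V_n^*$, $x_i^*\mapsto x_i^*$ for $i\le n$, $x_{n+1}^*\mapsto0$) gives maps $\mathfrak{l}^{n+1}\to\mathfrak{l}^n$, and $\mathfrak{l}^\infty=\varprojlim_n\mathfrak{l}^n$. $\mathfrak{l}_{Nk}$ denotes the part of tensor degree $2N$ in $V^*$ and degree $k$ in the factor $\widehat{\mathfrak{h}}[V]$. Product $\mu$: the tensor product of the products of $\widehat{S}(\widehat{\mathfrak{h}}_{\ge1}[V])$ and $\widehat{\mathfrak{h}}[V]$, restricted to invariants, assembled over $n$. Coproduct $\delta$: let $\delta_1$ be the cocommutative coproduct of $\widehat{S}(\widehat{\mathfrak{h}}_{\ge1}[V])$ with $\widehat{\mathfrak{h}}_{\ge1}[V]$ primitive and $\delta_2$ that of $\widehat{\mathfrak{h}}[V]=\widehat{S}(V^*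 )$ with $V^*$ primitive, and $\delta=\delta_1\hat\otimes\delta_2$ (tensor product coalgebra). For $m,n\ge1$ let $\pi_m,\pi_n$ be the restrictions along $V_m\to V_{m+n}$, $x_i\mapsto x_i$, and $V_n\to V_{m+n}$, $x_i\mapsto x_{m+i}$ (so $\pi_m(x_i^* )=x_i^*$, $\pi_m(x_{m+i}^* )=0$, $\pi_n(x_i^* )=0$, $\pi_n(x_{m+i}^* )=x_i^*$). The composites $\mathfrak{l}^\infty\to\mathfrak{l}^{m+n}\xrightarrow{(\pi_m\hat\otimes\pi_n)\circ\delta}\mathfrak{l}^m\hat\otimes\mathfrak{l}^n$ are compatible and define $\delta:\mathfrak{l}^\infty\to\mathfrak{l}^\infty\hat\otimes\mathfrak{l}^\infty=\varprojlim_{m,n}\mathfrak{l}^m\hat\otimes\mathfrak{l}^n$. The map $\Phi$: for a graph $\Gamma$ with internal vertices $v_1,\dots,v_m$ and external vertices $u_1,\dots,u_{k_0}$, and for $n\ge1$, set \[ \Phi^n(\Gamma)=\sum_{\ell:E(\Gamma)\to\{1,\dots,n\}}\Big(\prod_{j=1}^m\prod_{h\in v_j}x^*_{\ell(h)}\Big)\otimes\Big(\prod_{r=1}^{k_0}x^*_{\ell(u_r)}\Big)\in\big[S^m(\mathfrak{h}_{\ge1}[V_n])\otimes\mathfrak{h}[V_n]\big]^{O(n)}\subset\mathfrak{l}^n, \] where $\ell(h)$ is the label of the edge containing $h$, $\ell(u_r)$ the label of the edge containing the half-edge of $u_r$, each inner product $\prod_{h\in v_j}x^*_{\ell(h)}$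 is a monomial in $\mathfrak{h}_{\ge1}[V_n]$, and the outer product over $j$ is taken in $S^m(\mathfrak{h}_{\ge1}[V_n])$ (equivalently, each edge is decorated by $\sum_ix_i^*\otimes x_i^*$). Extending linearly and continuously, the maps $\Phi^n:\widehat{\mathcal{H}}\to\mathfrak{l}^n$ are compatible with the projections and define $\Phi:\widehat{\mathcal{H}}\to\mathfrak{l}^\infty$; a graph with $N$ edges and $k$ external vertices maps into $\mathfrak{l}^\infty_{Nk}$. *)

(* Defs.v *)
From mathcomp Require Import all_boot all_order all_algebra fingroup perm.
Set Implicit Arguments. Unset Strict Implicit. Unset Printing Implicit Defensive.
Import GRing.Theory.
Local Open Scope ring_scope.

(* Every graph with N edges is isomorphic to one whose half-edges are     *)
(* HE N = 'I_N * bool, with edges {(i,false),(i,true)}.  Such a concrete  *)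
(* graph is given by its vertex partition G.1 and set of external         *)
(* vertices G.2.                                                          *)
Definition HE (N : nat) := ('I_N * bool)%type.
Definition cgr (N : nat) := ({set {set HE N}} * {set {set HE N}})%type.

Definition valid N (G : cgr N) : bool :=
  [&& partition G.1 [set: HE N], G.2 \subset G.1 & [forall B in G.2, #|B| == 1%N]].

Definition edgepres N (s : {perm HE N}) : bool :=
  [forall h : HE N, (s h).1 == (s (h.1, ~~ h.2)).1].

Definition isoby N (s : {perm HE N}) (G G' : cgr N) : bool :=
  [&& edgepres s, [set s @: B | B : {set HE N} in G.1] == G'.1 & [set s @: B | B : {set HE N} in G.2] == G'.2].

Definition iso N (G G' : cgr N) : bool := [exists s : {perm HE N}, isoby s G G'].

Definition aut N (G : cgr N) : nat := #|[set s : {perm HE N} | isoby s G G]|.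
Definition orb N (G : cgr N) : nat := #|[set G' : cgr N | valid G' && iso G G']|.

Definition mapG a b (f : HE a -> HE b) (G : cgr a) : cgr b :=
  ([set f @: B | B : {set HE a} in G.1], [set f @: B | B : {set HE a} in G.2]).

Definition gunion a b (G1 : cgr a) (G2 : cgr b) : cgr (a + b) :=
  ((mapG (fun h : HE a => (@lshift a b h.1, h.2)) G1).1
     :|: (mapG (fun h : HE b => (@rshift a b h.1, h.2)) G2).1,
   (mapG (fun h : HE a => (@lshift a b h.1, h.2)) G1).2
     :|: (mapG (fun h : HE b => (@rshift a b h.1, h.2)) G2).2).

Definition castG a b (e : a = b) : cgr a -> cgr b :=
  mapG (fun h : HE a => (cast_ord e h.1, h.2)).

Lemma ord_split N (i : 'I_N.+1) : (i + (N - i))%N = N.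
Proof. by rewrite subnKC // -ltnS. Qed.

Section Alg.
Variable K : fieldType.

(* An element of \hat H: a coefficient function on (concrete) graphs,     *)
(* required to be invariant under isomorphism (values on non-valid         *)
(* graphs are irrelevant).  f represents  sum_[G] f(G) [G].               *)
Definition Hhat := forall N : nat, cgr N -> K.
Definition Hinv (f : Hhat) : Prop :=
  forall N (G G' : cgr N), valid G -> iso G G' -> f N G = f N G'.

(* An element of \hat H \hat\otimes \hat H = prod_{N1,N2} H_N1 (x) H_N2 *)
Definition Hhat2 := forall N1 N2 : nat, cgr N1 -> cgr N2 -> K.

Definition unitH : Hhat := fun N _ => (N == 0%N)%:R.

(* product (disjoint union), each pair of iso classes counted once *)
Definition prodH (f g : Hhat) : Hhat := fun N G =>
  \sum_(i < N.+1) \sum_(G1 : cgr i | valid G1) \sum_(G2 : cgr (N - i) | valid G2)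
    (if iso G (castG (ord_split i) (gunion G1 G2))
     then f i G1 * g (N - i)%N G2 / ((orb G1)%:R * (orb G2)%:R) else 0).

(* coproduct, from (I (x) I) o Delta = sqcup^* o I :
   coefficient of [G1] (x) [G2] is f(G1 u G2) |Aut(G1 u G2)| / (|Aut G1||Aut G2|) *)
Definition coprodH (f : Hhat) : Hhat2 := fun a b G1 G2 =>
  f (a + b)%N (gunion G1 G2) * (aut (gunion G1 G2))%:R
    / ((aut G1)%:R * (aut G2)%:R).

(* Index of a coordinate of S(h_{>=1}[V_n]) (x) h[V_n] in the (nested)     *)
(* symmetric-tensor realisation: x.1 = list of factors of h_{>=1}, each a *)
(* list of indices in 'I_n (a tensor in V_n^{*(x)d}), x.2 = list of        *)
(* indices (a tensor in V_n^{*(x)k}).  In characteristic 0 the coinvariant *)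
(* spaces W^{(x)d}/S_d are identified with symmetric tensors via           *)
(* [v] |-> (1/d!) sum_sigma sigma.v; an element of the completed space is *)
(* an arbitrary coefficient function on indices that is symmetric.        *)
Definition idx (n : nat) := (seq (seq 'I_n) * seq 'I_n)%type.

Definition key n (s : seq 'I_n) : seq nat := sort leq (map val s).
(* same orbit under outer permutations, inner permutations, and
   permutations of the h[V] factor *)
Definition equiv n (x y : idx n) : bool :=
  perm_eq x.2 y.2 && perm_eq (map (@key n) x.1) (map (@key n) y.1).

Definition tlen n (x : idx n) : nat := size (flatten x.1 ++ x.2).

Definition orbit_seq n (x : idx n) : seq (idx n) :=
  undup [seq y <- [seq (reshape sh (val w), drop (sumn sh) (val w))
                   | sh <- permutations (shape x.1),
                     w <- enum {: (tlen x).-tuple 'I_n}] | equiv y x].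
Definition orbsize n (x : idx n) : nat := size (orbit_seq x).

Definition Lfun (n : nat) := idx n -> K.
Definition Lfam := forall n : nat, Lfun n.

(* O(n) action: x_i^* |-> sum_j g j i x_j^* on every tensor slot *)
Definition actO n (g : 'M[K]_n) (T : Lfun n) : Lfun n := fun x =>
  let fl := flatten x.1 ++ x.2 in
  \sum_(w : (size fl).-tuple 'I_n)
    (\prod_(pr <- zip fl (val w)) g pr.1 pr.2) *
    T (reshape (shape x.1) (val w), drop (size (flatten x.1)) (val w)).

Definition widenI n (x : idx n) : idx n.+1 :=
  (map (map (widen_ord (leqnSn n))) x.1, map (widen_ord (leqnSn n)) x.2).

(* membership in l^infty = lim_n l^n : a compatible family of O(n)-invariant
   elements of \hat S(\hat h_{>=1}[V_n]) \hat(x) \hat h[V_n] *)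
Definition linf (c : Lfam) : Prop :=
  [/\ forall n (x y : idx n), equiv x y -> c n x = c n y,
      forall n (x : idx n), [::] \in x.1 -> c n x = 0,
      forall n (g : 'M[K]_n), g^T *m g = 1%:M -> forall x, actO g (c n) x = c n x
    & forall n (x : idx n), c n x = c n.+1 (widenI x)].

Definition unitL : Lfam := fun n x => (x == ([::], [::]))%:R.

Definition msk m (A : {set 'I_m}) : bitseq := [seq i \in A | i <- enum 'I_m].

(* product mu (symmetric algebra products, in symmetric-tensor form) *)
Definition prodL (a b : Lfam) : Lfam := fun n x =>
  \sum_(A : {set 'I_(size x.1)}) \sum_(B : {set 'I_(size x.2)})
    ('C(size x.1, #|A|)%:R)^-1 * ('C(size x.2, #|B|)%:R)^-1 *
    a n (mask (msk A) x.1, mask (msk B) x.2) *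
    b n (mask (msk (~: A)) x.1, mask (msk (~: B)) x.2).

(* (pi_m (x) pi_n) o delta on l^{m+n}, giving the (m,n) component *)
Definition deltaL (c : Lfam) : forall m n, idx m -> idx n -> K := fun m n x1 x2 =>
  'C(size x1.1 + size x2.1, size x1.1)%:R * 'C(size x1.2 + size x2.2, size x1.2)%:R *
  c (m + n)%N (map (map (@lshift m n)) x1.1 ++ map (map (@rshift m n)) x2.1,
               map (@lshift m n) x1.2 ++ map (@rshift m n) x2.2).

Definition Lab N n (G : cgr N) (l : {ffun 'I_N -> 'I_n}) : idx n :=
  ([seq [seq l h.1 | h <- enum (B : {set HE N})] | B <- enum (G.1 :\: G.2)],
   flatten [seq [seq l h.1 | h <- enum (B : {set HE N})] | B <- enum G.2]).

(* Phi^n(G) = sum_l (prod_j prod_{h in v_j} x^*_{l h}) (x) (prod_r x^*_{l u_r});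
   the basis element with index z corresponds to the symmetric tensor
   [equiv z x] / |orbit x|. *)
Definition PhiG N n (G : cgr N) : Lfun n := fun x =>
  (#|[set l : {ffun 'I_N -> 'I_n} | equiv (Lab G l) x]|)%:R / (orbsize x)%:R.

(* Phi on \hat H, extended linearly and continuously (only N <= tlen x
   can contribute to the coordinate x) *)
Definition PhiH (f : Hhat) : Lfam := fun n x =>
  \sum_(N < (tlen x).+1) \sum_(G : cgr N | valid G)
     f N G / (orb G)%:R * PhiG (n:=n) G x.

Definition PhiPhi (F : Hhat2) : forall m n, idx m -> idx n -> K := fun m n x1 x2 =>
  \sum_(N1 < (tlen x1).+1) \sum_(N2 < (tlen x2).+1)
  \sum_(G1 : cgr N1 | valid G1) \sum_(G2 : cgr N2 | valid G2)
     F N1 N2 G1 G2 / ((orb G1)%:R * (orb G2)%:R) * PhiG (n:=m) G1 x1 * PhiG (n:=n) G2 x2.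

End Alg.


Arguments unitH {K} N _.
Arguments prodH {K} f g N _.
Arguments coprodH {K} f N1 N2 _ _.
Arguments unitL {K} n x.
Arguments prodL {K} a b n x.
Arguments deltaL {K} c m n _ _.
Arguments PhiG {K N} n G _.
Arguments PhiH {K} f n x.
Arguments PhiPhi {K} F m n _ _.

(* Main.v *)
(** The coordinate of [Phi G] at an index [x] is a normalised count of the
    structure-preserving bijections from the half-edges of [G] to the tensor
    slots of [x], that is, a permanent of permanents ([nper]). Orthogonal
    invariance is visible on each bijection, the Laplace expansion of permanents
    gives compatibility with the product, and the coproduct is a count of
    labellings of a disjoint union.

    For bijectivity, call an index a pairing word if each letter occurs exactly
    twice. On the pairing word obtained by labelling the edges of [G] by distinct
    letters, [Phi f] has the value [f G] times a nonzero constant. So it suffices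
    that a stable invariant [c] vanishing on pairing words is zero. If a letter
    [a] occurs [k <> 2] times in [x], apply the reflection with entries 3/5, 4/5
    in the plane of [a] and a fresh letter [b]: up to words with more distinct
    letters, which vanish by induction, this gives
    [5^k c(x) = (3^k + 4^k) c(x)], hence [c(x) = 0]. *)

Require Import Defs.
From mathcomp Require Import all_boot all_order all_algebra fingroup perm.
From mathcomp Require Import zify ring.
(* mathcomp also exports an [equiv]; this puts the one of [Defs] back in front. *)
Import Defs.
Set Implicit Arguments. Unset Strict Implicit. Unset Printing Implicit Defensive.
Import GRing.Theory.
Local Open Scope ring_scope.

(** * Permanents *)

(** The defining form of [PhiG] counts labellings up to [equiv] and divides by an orbit size, which
    depends on repeated letters and behaves badly under splitting a word. An orbit-stabiliser
    argument trades it for a permanent divided by [ngroup], a number that depends on the shape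
    alone. Both forms are kept: permanents serve the orthogonal action and the product, counting
    serves the coproduct, where the two halves of a word have disjoint letters.

    Surjectivity is a statement about the limit. For a fixed small [n] the images of graphs satisfy
    linear relations, and the pairing word of a graph with [N] edges already takes [N] letters.
    Stability supplies a fresh letter whenever one is wanted, and the length of a word bounds its
    number of distinct letters, so the induction ends.

    Since [K] is any field of characteristic zero, the reflection must have rational entries. The
    triple 3, 4, 5 provides one that treats all exponents at once: for [k > 0], [3^k + 4^k = 5^k]
    only if [k = 2]. *)

Lemma perm_map_lift (A B : eqType) (f : A -> B) (w : seq B) (s : seq A) :
  perm_eq w (map f s) -> exists2 s', perm_eq s' s & w = map f s'.
Proof.
case: s => [|a s] h; first by exists [::] => //; apply/nilP; rewrite /nilp (perm_size h).
have /(perm_iotaP (f a)) [Is hIs ->] := h.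
exists [seq nth a (a :: s) i | i <- Is].
  rewrite -{2}(mkseq_nth a (a :: s)); apply: perm_map.
  by rewrite (permPl hIs) size_map.
rewrite -map_comp; apply/eq_in_map => i; rewrite (perm_mem hIs) mem_iota size_map /= => hi.
by rewrite -(nth_map a (f a) f (s := a :: s)).
Qed.

Section Permanent.
Variable R : comNzRingType.

Fixpoint picks (B : Type) (v : seq B) : seq (B * seq B) :=
  if v is b :: v' then (b, v') :: [seq (p.1, b :: p.2) | p <- picks v'] else [::].

(** The permanent of the matrix [r], expanded along its first row; lists of different lengths give
    0. Recursion on lists counts bijections of positions, so repeated entries keep their
    multiplicity, and the kernel may itself be a permanent. *)
Fixpoint per (A B : Type) (r : A -> B -> R) (u : seq A) (v : seq B) : R :=
  if u is a :: u' then \sum_(p <- picks v) r a p.1 * per r u' p.2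
  else (size v == 0%N)%:R.

Lemma picks_map (B C : Type) (f : B -> C) v :
  picks (map f v) = [seq (f p.1, map f p.2) | p <- picks v].
Proof. by elim: v => //= b v ->; rewrite -!map_comp. Qed.

Lemma per_map (A B A' B' : Type) (r : A' -> B' -> R) (f : A -> A') (g : B -> B') u v :
  per r (map f u) (map g v) = per (fun a b => r (f a) (g b)) u v.
Proof.
elim: u v => [|a u IH] v /=; first by rewrite size_map.
by rewrite picks_map big_map; apply: eq_bigr => p _; rewrite IH.
Qed.

Lemma eq_per (A B : Type) (r r' : A -> B -> R) : r =2 r' -> per r =2 per r'.
Proof. by move=> e; elim=> //= a u IH v; apply: eq_bigr => p _; rewrite e IH. Qed.

Lemma picks_perm (B : eqType) (v : seq B) p : p \in picks v -> perm_eq (p.1 :: p.2) v.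
Proof.
elim: v p => //= b v IH p; rewrite inE => /orP[/eqP -> //|/mapP[q /IH hq ->]] /=.
by rewrite (perm_catCA [:: q.1] [:: b]) /= perm_cons.
Qed.

Lemma size_picks (B : Type) (v : seq B) : size (picks v) = size v.
Proof. by elim: v => //= b v IH; rewrite size_map IH. Qed.

Lemma per_size (A : Type) (B : eqType) (r : A -> B -> R) u v :
  size u <> size v -> per r u v = 0.
Proof.
elim: u v => [|a u IH] v /= h; first by case: eqP => // e; case: h; rewrite e.
rewrite big1_seq // => p /andP[_ /picks_perm /perm_size /= hp].
by rewrite IH ?mulr0 // => e; apply: h; rewrite e.
Qed.

(** Two successive removals can be made in either order. This is the symmetry behind the exchange of
    two adjacent rows. *)
Lemma picks_swap (B : Type) (H : B -> B -> seq B -> R) v :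
  \sum_(p <- picks v) \sum_(q <- picks p.2) H p.1 q.1 q.2
  = \sum_(p <- picks v) \sum_(q <- picks p.2) H q.1 p.1 q.2.
Proof.
elim: v H => [|b v IH] H /=; first by rewrite !big_nil.
rewrite !big_cons !big_map /=.
under [X in _ + X = _]eq_bigr do rewrite big_cons big_map /=.
under [X in _ = _ + X]eq_bigr do rewrite big_cons big_map /=.
by rewrite !big_split /= (IH (fun a c s => H a c (b :: s))) addrCA.
Qed.

Lemma per_swap (A B : Type) (r : A -> B -> R) a a' u v :
  per r (a :: a' :: u) v = per r (a' :: a :: u) v.
Proof.
rewrite /=; under eq_bigr do rewrite big_distrr /=.
under [RHS]eq_bigr do rewrite big_distrr /=.
rewrite (picks_swap (fun x y s => r a x * (r a' y * per r u s))).
by apply: eq_bigr => p _; apply: eq_bigr => q _; rewrite mulrCA.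
Qed.

Lemma per_perml (A : eqType) (B : Type) (r : A -> B -> R) u u' v :
  perm_eq u u' -> per r u v = per r u' v.
Proof.
(* Adjacent exchanges carry any row to the front. *)
have cons_cat a p q w : per r (p ++ a :: q) w = per r (a :: p ++ q) w.
  elim: p w => // c p IH w; rewrite [RHS]per_swap /=.
  by apply: eq_bigr => x _; rewrite IH.
elim: u u' v => [|a u IH] u' v h.
  by have /eqP := perm_size h; rewrite eq_sym => /nilP ->.
have /path.splitPr ha : a \in u' by rewrite -(perm_mem h) mem_head.
case: ha h => p q h; rewrite cons_cat /=; apply: eq_bigr => x _; rewrite (IH (p ++ q)) //.
by move: h; rewrite perm_sym -[a :: q]cat1s perm_catCA /= perm_cons perm_sym.
Qed.

Fixpoint bits m : seq bitseq :=
  if m is m'.+1 then map (cons true) (bits m') ++ map (cons false) (bits m') else [:: [::]].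

(** Removing an entry and then splitting the rest is the same as splitting first and then removing
    an entry of the selected part. It is the inductive step of the Laplace expansion; [bits_nilmask]
    is its base. *)
Lemma splits_picks (B : Type) (H : B -> seq B -> seq B -> R) v :
  \sum_(p <- picks v) \sum_(m <- bits (size p.2)) H p.1 (mask m p.2) (mask (map negb m) p.2)
  = \sum_(m <- bits (size v)) \sum_(q <- picks (mask m v)) H q.1 q.2 (mask (map negb m) v).
Proof.
elim: v H => [|b v IH] H /=; first by rewrite big_nil big_seq1 big_nil.
rewrite big_cons big_map /=; under [X in _ + X = _]eq_bigr do rewrite big_cat !big_map /=.
rewrite big_split /= big_cat !big_map /=.
under [X in _ = X + _]eq_bigr do rewrite big_cons big_map /=.
rewrite big_split /= (IH (fun c s t => H c (b :: s) t)) (IH (fun c s t => H c s (b :: t))).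
by rewrite addrA.
Qed.

Lemma bits_nilmask (B : Type) (F : seq B -> R) v :
  \sum_(m <- bits (size v)) (size (mask m v) == 0%N)%:R * F (mask (map negb m) v) = F v.
Proof.
elim: v F => [|b v IH] F /=; first by rewrite big_seq1 mul1r.
rewrite big_cat !big_map /= big1 ?add0r; last by move=> i _; rewrite mul0r.
exact: (IH (fun s => F (b :: s))).
Qed.

Lemma per_Laplace (A B : Type) (r : A -> B -> R) u1 u2 v :
  per r (u1 ++ u2) v =
  \sum_(m <- bits (size v)) per r u1 (mask m v) * per r u2 (mask (map negb m) v).
Proof.
elim: u1 v => [|a u IH] v /=; first by rewrite bits_nilmask.
under eq_bigr do rewrite IH big_distrr /=.
rewrite (splits_picks (fun b s t => r a b * (per r u s * per r u2 t))).
by apply: eq_bigr => m _; rewrite big_distrl /=; apply: eq_bigr => q _; rewrite mulrA.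
Qed.

(** A block triangular permanent: a row of [u1] can only be matched inside [v1], and equal sizes
    then leave [v2] to [u2]. *)
Lemma per_block (A B : eqType) (r : A -> B -> R) u1 u2 v1 v2 : size u1 = size v1 ->
  (forall a b, a \in u1 -> b \in v2 -> r a b = 0) ->
  per r (u1 ++ u2) (v1 ++ v2) = per r u1 v1 * per r u2 v2.
Proof.
have pc (s t : seq B) : picks (s ++ t) = [seq (p.1, p.2 ++ t) | p <- picks s]
    ++ [seq (p.1, s ++ p.2) | p <- picks t].
  elim: s => [|b s IH] /=; first by elim: (picks t) => //= -[a x] l {1}->.
  by rewrite IH map_cat -!map_comp.
elim: u1 v1 => [|a u IH] [|b0 v] //= hs h0; first by rewrite mul1r.
rewrite -!/(picks (b0 :: v)) -/((b0 :: v) ++ v2) -/(cat (b0 :: v) v2).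
have -> : (b0, v ++ v2) :: [seq (p.1,
  b0 :: p.2) | p <- picks (v ++ v2)] = picks ((b0 :: v) ++ v2) by [].
(* The picks taken from [v2] carry a vanishing factor. *)
rewrite pc big_cat !big_map /= [X in _ + X]big1_seq ?addr0; last first.
  move=> p /andP[_ /picks_perm hp]; rewrite h0 ?mul0r ?mem_head //.
  by rewrite -(perm_mem hp) mem_head.
rewrite big_distrl /=; apply: eq_big_seq => p hp.
rewrite -mulrA -IH //.
  by have /perm_size /= := @picks_perm _ (b0 :: v) p hp; move=> [->]; case: hs.
by move=> x y hx hy; apply: h0 => //; rewrite inE hx orbT.
Qed.

(* The set L of rearrangements of v does not depend on the kernel r. *)
Lemma per_expand (A : Type) (B : eqType) u (v : seq B) :
  exists2 L : seq (seq B), {in L, forall s, perm_eq s v && (size s == size u)} &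
  forall r : A -> B -> R, per r u v = \sum_(s <- L) \prod_(z <- zip u s) r z.1 z.2.
Proof.
elim: u v => [|a u IH] v /=.
  exists (if size v == 0%N then [:: [::]] else [::]).
    by move=> s; case: v => //=; rewrite inE => /eqP ->.
  by move=> r; case: v => //=; rewrite ?big_seq1 ?big_nil.
have := @picks_perm _ v; elim: (picks v) => [|p l IHl] hp.
  by exists [::] => // r; rewrite !big_nil.
have [L1 h1 e1] := IHl (fun q hq => hp q (mem_behead (s := p :: l) hq)).
have [L2 h2 e2] := IH p.2.
exists ([seq p.1 :: s | s <- L2] ++ L1).
  move=> s; rewrite mem_cat => /orP[/mapP[s' /h2 /andP[hs1 hs2] ->]|/h1 //].
  rewrite /= eqSS hs2 andbT; apply: perm_trans (hp p (mem_head _ _)).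
  by rewrite perm_cons.
move=> r; rewrite big_cons big_cat -e1 big_map; congr (_ + _).
by rewrite e2 big_distrr /=; apply: eq_bigr => s _; rewrite big_cons.
Qed.

(** A permanent of permanents is again a sum over rearrangements of the flattened slots. As [L] is
    chosen before [r], one list can serve kernels that vary with a labelling and a word. *)
Lemma per_per_expand (A : Type) (B : eqType) (Y : seq (seq A)) (X : seq (seq B)) :
  exists2 L : seq (seq B),
    {in L, forall s, perm_eq s (flatten X) && (size s == size (flatten Y))} &
  forall r : A -> B -> R,
    per (per r) Y X = \sum_(s <- L) \prod_(z <- zip (flatten Y) s) r z.1 z.2.
Proof.
elim: Y X => [|u Y IH] X /=.
  exists (if size X == 0%N then [:: [::]] else [::]).
    by move=> s; case: X => //=; rewrite inE => /eqP ->.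
  by move=> r; case: X => //=; rewrite ?big_seq1 ?big_nil.
have := @picks_perm _ X; elim: (picks X) => [|p l IHl] hp.
  by exists [::] => // r; rewrite !big_nil.
have [L1 h1 e1] := IHl (fun q hq => hp q (mem_behead (s := p :: l) hq)).
have [L2 h2 e2] := IH p.2; have [L3 h3 e3] := per_expand u p.1.
exists ([seq s ++ t | s <- L3, t <- L2] ++ L1).
  move=> s; rewrite mem_cat => /orP[/allpairsP[[s3 s2] /= [/h3/andP[a3 b3] /h2/andP[a2 b2]
    ->]]|/h1 //].
  rewrite !size_cat (eqP b3) (eqP b2) eqxx andbT.
  by apply: perm_trans (perm_flatten (hp p (mem_head _ _))); apply: perm_cat.
move=> r; rewrite big_cons big_cat -e1; congr (_ + _).
rewrite big_allpairs_dep /= e3 e2 big_distrl /=; apply: eq_big_seq => s /h3/andP[_ /eqP hs].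
by rewrite big_distrr /=; apply: eq_bigr => t _; rewrite zip_cat // big_cat.
Qed.

(** * Kernels constant on key classes, and column sums of permanents *)

Section Key.
Variables (T U : eqType) (k : T -> U) (r : T -> T -> R).
Hypothesis r0 : forall y x, k y <> k x -> r y x = 0.
Hypothesis rk : forall y y' x, k y = k y' -> r y x = r y' x.

(** Meant for the outer permanent: there [r] is the inner permanent of the Kronecker kernel and [k]
    is [key], so that blocks are compared up to reordering. *)
Lemma per_key0 u v : ~~ perm_eq (map k u) (map k v) -> per r u v = 0.
Proof.
elim: u v => [|a u IH] v /=; first by case: v.
move=> h; rewrite big1_seq // => p /andP[_ /picks_perm hp].
have [e|/r0 ->] := k a =P k p.1; last by rewrite mul0r.
rewrite IH ?mulr0 //; apply: contra h => h.
by apply: perm_trans (perm_map k hp); rewrite e perm_cons.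
Qed.

Lemma per_keyl u u' v : perm_eq (map k u) (map k u') -> per r u v = per r u' v.
Proof.
move=> /perm_map_lift [u'' /(per_perml r v) <- e].
elim: u u'' v e => [|a u IH] [|a' u''] // v [/rk e /IH h] /=.
by apply: eq_bigr => p _; rewrite e h.
Qed.

(** The column of [x] has finite support and sum [om x]. The support is an explicit list because the
    row type, of words or lists of words, may be infinite. *)
Definition total_mass (om : T -> R) := forall x, exists2 L : seq T, uniq L &
  (forall y, y \notin L -> r y x = 0) /\ \sum_(y <- L) r y x = om x.

End Key.

Lemma big_support (T : eqType) (F : T -> R) (L L' : seq T) : uniq L -> uniq L' ->
  (forall y, y \notin L -> F y = 0) -> (forall y, y \notin L' -> F y = 0) ->
  \sum_(y <- L') F y = \sum_(y <- L) F y.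
Proof.
have sub (L1 L2 : seq T) : uniq L1 -> uniq L2 -> {subset L1 <= L2} ->
    (forall y, y \notin L1 -> F y = 0) -> \sum_(y <- L2) F y = \sum_(y <- L1) F y.
  move=> u1 u2 s12 F0; rewrite (bigID (mem L1)) /= [X in _ + X]big1 ?addr0 //.
  rewrite -big_filter; apply: perm_big; apply: uniq_perm => //; first exact: filter_uniq.
  by move=> y; rewrite mem_filter; case hy: (y \in L1) => //=; apply: s12.
move=> uL uL' z z'; rewrite -(sub L (undup (L ++ L'))) ?undup_uniq //.
  by rewrite (sub L' (undup (L ++ L'))) ?undup_uniq // => y hy; rewrite mem_undup mem_cat hy orbT.
by move=> y hy; rewrite mem_undup mem_cat hy.
Qed.

(** Summed over all row lists, each of the [(size v)!] bijections contributes the product of the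
    column sums. The result has the same form as the hypothesis, so it can be applied again to
    nested permanents. *)
Lemma total_mass_per (T : eqType) (r : T -> T -> R) om : total_mass r om ->
  total_mass (per r) (fun v => (size v)`!%:R * \prod_(b <- v) om b).
Proof.
move=> tr v; elim: {v}(size v) {-2}v (erefl (size v)) => [|m IH] v hv.
  case: v hv => // _; exists [:: [::]] => //; split; last by rewrite big_seq1 /= big_nil mulr1.
  by move=> y hy; apply: per_size; case: y hy.
(* [S] and, below, [Z] are supports common to all picks of [v], for the head and the tail of a row
   list respectively. *)
have [S [uS hS]] : exists S : seq T, uniq S /\
    {in picks v, forall p, forall y, y \notin S -> r y p.1 = 0}.
  elim: (picks v) => [|p l [S [_ hS]]]; first by exists [::].
  have [L uL [hL _]] := tr p.1; exists (undup (L ++ S)); split; first exact: undup_uniq.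
  move=> q; rewrite inE => /orP[/eqP ->|hq] y; rewrite mem_undup mem_cat negb_or => /andP[h1 h2].
    exact: hL.
  exact: hS.
have [Z [uZ hZ]] : exists Z : seq (seq T), uniq Z /\ {in picks v, forall p,
    (forall y, y \notin Z -> per r y p.2 = 0)
    /\ \sum_(y <- Z) per r y p.2 = m`!%:R * \prod_(b <- p.2) om b}.
  have : {in picks v, forall p, size p.2 = m}.
    by move=> p /picks_perm /perm_size /=; rewrite hv => -[].
  elim: (picks v) => [|p l IHl] hl; first by exists [::].
  have {}/IHl [S' [uS' hS']] : {in l, forall p, size p.2 = m}.
    by move=> q hq; apply: hl; rewrite inE hq orbT.
  have [L uL [hL sL]] := IH p.2 (hl p (mem_head _ _)).
  exists (undup (L ++ S')); split=> [|q]; first exact: undup_uniq.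
  have z1 y : y \notin undup (L ++ S') -> per r y p.2 = 0.
    by rewrite mem_undup mem_cat negb_or => /andP[/hL].
  rewrite inE => /orP[/eqP ->|hq].
    by split=> //; rewrite (big_support uL (undup_uniq _) hL z1) sL hl ?mem_head.
  have z2 y : y \notin undup (L ++ S') -> per r y q.2 = 0.
    by rewrite mem_undup mem_cat negb_or => /andP[_ /(hS' q hq).1].
  by split=> //; rewrite (big_support uS' (undup_uniq _) (hS' q hq).1 z2) (hS' q hq).2.
exists [seq a :: u | a <- S, u <- Z].
  by apply: allpairs_uniq => // -[a u] [a' u'] _ _ /= [-> ->].
split=> [y hy|].
  case: y hy => [|a u] hy; first by apply: per_size; rewrite hv.
  rewrite /= big1_seq // => p /andP[_ hp].
  have [ha|/(hS p hp) ->] := boolP (a \in S); last by rewrite mul0r.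
  have [hu|/((hZ p hp).1) ->] := boolP (u \in Z); last by rewrite mulr0.
  by case/negP: hy; apply: allpairs_f.
rewrite big_allpairs_dep /=; under eq_bigr do rewrite exchange_big.
rewrite exchange_big /=.
rewrite (eq_big_seq (fun _ => m`!%:R * \prod_(b <- v) om b)).
  by rewrite big_const_seq count_predT size_picks iter_addr_0 hv factS natrM -[LHS]mulr_natl !mulrA.
move=> p hp; under eq_bigr do rewrite -big_distrr /= (hZ p hp).2.
have [L uL [hL sL]] := tr p.1.
rewrite -big_distrl /= (big_support uL uS hL (hS p hp)) sL mulrCA.
by rewrite -(perm_big _ (picks_perm hp)) /= big_cons.
Qed.

End Permanent.

(** * Nested permanents and orbit sizes *)

Lemma key_eq n (s t : seq 'I_n) : (key s == key t) = perm_eq s t.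
Proof.
apply/eqP/idP => [|h].
  move/(perm_sortP leq_total leq_trans anti_leq) => /perm_map_lift [s' h e].
  by rewrite (inj_map val_inj e).
by apply/(perm_sortP leq_total leq_trans anti_leq); apply: perm_map.
Qed.

Lemma size_key n (s : seq 'I_n) : size (key s) = size s.
Proof. by rewrite size_sort size_map. Qed.

Section Equiv.
Variable n : nat.
Implicit Types x y z : idx n.

Lemma equiv_refl x : equiv x x.
Proof. by rewrite /equiv !perm_refl. Qed.

Lemma equiv_sym x y : equiv x y = equiv y x.
Proof. by rewrite /equiv perm_sym [X in _ && X]perm_sym. Qed.

Lemma equiv_trans y x z : equiv x y -> equiv y z -> equiv x z.
Proof. by move=> /andP[a b] /andP[c d]; rewrite /equiv (perm_trans a c) (perm_trans b d). Qed.

Lemma equiv_eql x y : equiv x y -> (@equiv n)^~ x =1 (@equiv n)^~ y.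
Proof. by move=> h z; apply/idP/idP => h'; apply: equiv_trans h' _ => //; rewrite equiv_sym. Qed.

Lemma equiv_eqr x y : equiv x y -> equiv x =1 equiv y.
Proof. by move=> h z; apply/idP/idP; apply: equiv_trans => //; rewrite equiv_sym. Qed.

Lemma equiv_shape x y : equiv x y -> perm_eq (shape x.1) (shape y.1).
Proof.
move=> /andP[_ /(perm_map size)]; rewrite -!map_comp.
by rewrite !(@eq_map _ _ (size \o @key n) size) // => s; rewrite /= size_key.
Qed.

Lemma equiv_flat x y : equiv x y -> perm_eq (flatten x.1 ++ x.2) (flatten y.1 ++ y.2).
Proof.
move=> /andP[h2 /perm_map_lift [Y hY e]]; apply: perm_cat => //.
apply: perm_trans (perm_flatten hY) => {h2 hY}.
elim: x.1 Y e => [|s X IH] [|t Y] //= [/eqP + /IH h]; rewrite key_eq => h'.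
exact: perm_cat.
Qed.

Lemma equiv_tlen x y : equiv x y -> tlen x = tlen y.
Proof. by move/equiv_flat/perm_size. Qed.

Lemma equiv_nil x y : equiv x y -> ([::] \in x.1) = ([::] \in y.1).
Proof.
move=> /andP[_ /perm_mem /(_ [::])].
have h z : ([::] \in z.1) = ([::] \in map (@key n) z.1).
  apply/idP/mapP => [h|[s h /esym/eqP]]; first by exists [::].
  by rewrite -size_eq0 size_key size_eq0 => /eqP <-.
by rewrite -!h.
Qed.

Lemma reshape_flatten (A : Type) (X : seq (seq A)) t : reshape (shape X) (flatten X ++ t) = X.
Proof. by elim: X => //= s X IH; rewrite -catA take_size_cat // drop_size_cat // IH. Qed.

(** The filter in [orbit_seq] gives one direction. For the other, an equivalent [y] is recovered
    from its shape, a permutation of that of [x], and its flattening, a word of the same length. *)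
Lemma mem_orbit_seq x y : (y \in orbit_seq x) = equiv y x.
Proof.
rewrite mem_undup mem_filter; case h: (equiv y x) => //=.
apply/allpairsP.
have hs : size (flatten y.1 ++ y.2) == tlen x by rewrite -(equiv_tlen h).
exists (shape y.1, Tuple hs); split => /=.
- by rewrite mem_permutations equiv_shape.
- by rewrite mem_enum.
by rewrite reshape_flatten drop_size_cat ?size_flatten //; case: y {h hs}.
Qed.

Lemma equiv_orbsize x y : equiv x y -> orbsize x = orbsize y.
Proof.
move=> h; apply/perm_size/uniq_perm; rewrite ?undup_uniq // => z.
by rewrite !mem_orbit_seq (equiv_eql h).
Qed.

End Equiv.

Definition nmap (A B : Type) (f : A -> B) (x : seq (seq A) * seq A) :=
  (map (map f) x.1, map f x.2).

Section NestedPermanent.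
Variable K : fieldType.

Definition nper (A B : Type) (r : A -> B ->
  K) (y : seq (seq A) * seq A) (x : seq (seq B) * seq B) :=
  per (per r) y.1 x.1 * per r y.2 x.2.

Definition kdelta (A : eqType) (a b : A) : K := (a == b)%:R.

(** Counts the structure-preserving bijections of slots that preserve letters; for [y = x] it is the
    order of the stabiliser. *)
Definition nperd n (y x : idx n) : K := nper (@kdelta 'I_n) y x.

(** The number of ways to permute the blocks, the entries inside each block, and the last list. *)
Definition ngroup n (x : idx n) : K :=
  (size x.1)`!%:R * \prod_(b <- x.1) (size b)`!%:R * (size x.2)`!%:R.

Lemma nper_nmap (A B A' B' : Type) (r : A' -> B' -> K) (f : A -> A') (g : B -> B') y x :
  nper r (nmap f y) (nmap g x) = nper (fun a b => r (f a) (g b)) y x.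
Proof.
rewrite /nper /nmap /= !per_map; congr (_ * _); apply: eq_per => a b; exact: per_map.
Qed.

Lemma kdelta_per_perm (A : eqType) (u u' v : seq A) : perm_eq u u' ->
  per (@kdelta A) u v = per (@kdelta A) u' v.
Proof. exact: per_perml. Qed.

Lemma kdelta_per0 (A : eqType) (u v : seq A) : ~~ perm_eq u v -> per (@kdelta A) u v = 0.
Proof.
move=> h; apply: (per_key0 (k := id)); last by rewrite !map_id.
by move=> y x /eqP; rewrite /kdelta => /negPf ->.
Qed.

Lemma kdelta_total (A : eqType) : total_mass (@kdelta A) (fun=> 1).
Proof.
move=> x; exists [:: x] => //; split; last by rewrite big_seq1 /kdelta eqxx.
by move=> y; rewrite inE /kdelta => /negPf ->.
Qed.

Lemma nperd_equiv n (y x : idx n) : nperd y x = (equiv y x)%:R * nperd x x.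
Proof.
have r0 (s t : seq 'I_n) : key s <> key t -> per (@kdelta 'I_n) s t = 0.
  by move/eqP; rewrite key_eq; apply: kdelta_per0.
rewrite /equiv; have [h2|/kdelta_per0 h] /= := boolP (perm_eq y.2 x.2); last first.
  by rewrite mul0r /nperd /nper h mulr0.
have [h1|h] /= := boolP (perm_eq (map _ _) _); last first.
  by rewrite mul0r /nperd /nper (per_key0 r0) ?mul0r.
rewrite mul1r /nperd /nper (kdelta_per_perm _ h2) (per_keyl (k := @key n) _ _ h1) //.
by move=> s s' t /eqP; rewrite key_eq; apply: kdelta_per_perm.
Qed.

(** Orbit-stabiliser, obtained by summing [nperd y x] over [y] in two ways: it is constant on the
    orbit and zero off it, and its total mass is [ngroup]. *)
Lemma orbsize_nperd n (x : idx n) : (orbsize x)%:R * nperd x x = ngroup x.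
Proof.
have [L1 u1 [z1 s1]] := total_mass_per (total_mass_per (@kdelta_total 'I_n)) x.1.
have [L2 u2 [z2 s2]] := total_mass_per (@kdelta_total 'I_n) x.2.
transitivity (\sum_(y <- orbit_seq x) nperd y x).
  rewrite (eq_big_seq (fun=> nperd x x)).
    by rewrite big_const_seq count_predT iter_addr_0 mulr_natl.
  by move=> y; rewrite mem_orbit_seq => h; rewrite nperd_equiv h mul1r.
(* The orbit supports the summand, so it may be replaced by a product of supports, over which the
   sum factors. *)
rewrite (@big_support _ _ _ [seq (a, b) | a <- L1, b <- L2]); first 1 last.
- by apply: allpairs_uniq => // -[a b] [a' b'].
- exact: undup_uniq.
- move=> [a b] h; rewrite /nperd /nper /=.
  have [ha|/z1 ->] := boolP (a \in L1); last by rewrite mul0r.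
  have [hb|/z2 ->] := boolP (b \in L2); last by rewrite mulr0.
  by case/negP: h; apply: allpairs_f.
- by move=> y; rewrite mem_orbit_seq nperd_equiv => /negPf ->; rewrite mul0r.
rewrite big_allpairs_dep /= /nperd /nper /=.
under eq_bigr do rewrite -big_distrr /= s2.
rewrite -big_distrl /= s1 /ngroup; congr (_ * _ * _); last by rewrite big1 ?mulr1.
by apply: eq_bigr => b _; rewrite big1 ?mulr1.
Qed.

Hypothesis hK : [pchar K] =i pred0.

Lemma natr_neq0 m : (0 < m)%N -> m%:R != 0 :> K.
Proof. by move/pcharf0P: hK => ->; rewrite -lt0n. Qed.

Lemma ngroup_neq0 n (x : idx n) : ngroup x != 0.
Proof.
by rewrite !mulf_neq0 ?natr_neq0 ?fact_gt0 // prodf_seq_neq0; apply/allP => b _ /=;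
  rewrite natr_neq0 ?fact_gt0.
Qed.

(** The passage from counting to permanents: the new denominator depends only on the shape of [x],
    and the new numerator has a Laplace expansion. *)
Lemma equiv_orbsizeE n (y x : idx n) : (equiv y x)%:R / (orbsize x)%:R = nperd y x / ngroup x.
Proof.
have := ngroup_neq0 x; rewrite -orbsize_nperd mulf_eq0 negb_or => /andP[h1 h2].
by rewrite (nperd_equiv y) invfM [_^-1 * _^-1]mulrC mulrA mulfK.
Qed.

Lemma PhiG_sum N n (G : cgr N) (x : idx n) :
  PhiG n G x = \sum_(l : {ffun 'I_N -> 'I_n}) (equiv (Lab G l) x)%:R / (orbsize x)%:R :> K.
Proof.
rewrite -big_distrl /=; congr (_ / _).
by rewrite -natr_sum -sum1_card big_mkcond /=; congr _%:R; apply: eq_bigr => l _; rewrite inE;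
  case: ifP.
Qed.

Lemma PhiG_nper N n (G : cgr N) (x : idx n) :
  PhiG n G x = (\sum_(l : {ffun 'I_N -> 'I_n}) nperd (Lab G l) x) / ngroup x.
Proof. by rewrite PhiG_sum big_distrl /=; apply: eq_bigr => l _; rewrite equiv_orbsizeE. Qed.

End NestedPermanent.

(** * Graphs listed by their half-edges *)

Lemma bij_from_lists (T1 T2 : finType) (s1 : seq T1) (s2 : seq T2) :
  perm_eq s1 (enum T1) -> perm_eq s2 (enum T2) -> size s1 = size s2 ->
  exists2 f : T1 -> T2, bijective f & map f s1 = s2.
Proof.
move=> h1 h2 es.
have u1 : uniq s1 by rewrite (perm_uniq h1) enum_uniq.
have lt x : (index x s1 < size s2)%N by rewrite -es index_mem (perm_mem h1) mem_enum.
pose f x := tnth (in_tuple s2) (Ordinal (lt x)).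
have ef : map f s1 = s2.
  case: (pickP (mem s1)) => [x0 _|n0]; last first.
    have e1 : size s1 = 0%N by case: (s1) n0 => // x t /(_ x); rewrite /= mem_head.
    by transitivity (Nil T2); [apply: size0nil; rewrite size_map | apply/esym/size0nil;
      rewrite -es].
  apply: (@eq_from_nth _ (f x0)); rewrite size_map ?es // => i hi.
  by rewrite (nth_map x0) ?es // /f (tnth_nth (f x0)) /= index_uniq ?es.
exists f => //; apply: inj_card_bij.
  apply/injectiveP; rewrite /injectiveb /dinjectiveb -(perm_uniq (perm_map f h1)) ef.
  by rewrite (perm_uniq h2) enum_uniq.
by rewrite !cardT -(perm_size h1) -(perm_size h2) es.
Qed.

Lemma perm_from_lists (T : finType) (s1 s2 : seq T) :
  perm_eq s1 (enum T) -> perm_eq s2 (enum T) -> exists p : {perm T}, map p s1 = s2.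
Proof.
move=> h1 h2; have [|f /bij_inj fI <-] := bij_from_lists h1 h2.
  by rewrite (perm_size h1) (perm_size h2).
by exists (perm fI); apply: eq_map => x; rewrite permE.
Qed.

Lemma perm_extend (T : finType) (s : seq T) : uniq s ->
  exists t, perm_eq (s ++ t) (enum T).
Proof.
move=> us; exists [seq x <- enum T | x \notin s].
apply: uniq_perm => [||x]; rewrite ?enum_uniq //.
  rewrite cat_uniq us filter_uniq ?enum_uniq // andbT -all_predC.
  by apply/allP => x; rewrite mem_filter => /andP[].
by rewrite mem_cat mem_filter mem_enum andbT orbN.
Qed.

(** An equivalence of labelled words is realised on the labelled objects: [X1] reorders the blocks
    of [X], and [X2] then reorders each block. *)
Lemma nested_lift n (A B : eqType) (f : A -> 'I_n) (g : B ->
  'I_n) (Y : seq (seq A)) (X : seq (seq B)) :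
  perm_eq (map (@key n) (map (map f) Y)) (map (@key n) (map (map g) X)) ->
  exists X1 X2, [/\ perm_eq X1 X,
    all2 (fun a b => perm_eq a b) X2 X1 & map (map f) Y = map (map g) X2].
Proof.
rewrite -[X in perm_eq _ X]map_comp => /perm_map_lift [X1 h1 e]; exists X1.
suff [X2 h2 e2] : exists2 X2, all2 (fun a b => perm_eq a b) X2 X1 & map (map f) Y = map (map g) X2.
  by exists X2.
elim: Y X1 {h1} e => [|y Y IH] [|x X1] //=; first by exists [::].
move=> [/eqP + /IH [X2 h2 ->]]; rewrite key_eq => /perm_map_lift [x' hx ->].
by exists (x' :: X2) => //=; rewrite hx.
Qed.

Definition nflat (A : Type) (z : seq (seq A) * seq A) := flatten z.1 ++ z.2.

Definition ncat (A : Type) (z z' : seq (seq A) * seq A) := (z.1 ++ z'.1, z.2 ++ z'.2).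

Lemma shape_nmap (A B : Type) (f : A -> B) X : shape (map (map f) X) = shape X.
Proof. by rewrite /shape -map_comp; apply: eq_map => t /=; rewrite size_map. Qed.

Lemma nflat_nmap (A B : Type) (f : A -> B) z : nflat (nmap f z) = map f (nflat z).
Proof. by rewrite /nflat map_cat map_flatten. Qed.

Lemma nmap_comp (A B C : Type) (g : B -> C) (f : A -> B) z : nmap g (nmap f z) = nmap (g \o f) z.
Proof.
rewrite /nmap /= -!map_comp; congr (_, _).
by apply: eq_map => s /=; rewrite -map_comp.
Qed.

Lemma nmap_id (A : Type) (z : seq (seq A) * seq A) : nmap id z = z.
Proof. by rewrite /nmap map_id (eq_map (@map_id _)) map_id; case: z. Qed.

Lemma eq_nmap (A B : Type) (f g : A -> B) : f =1 g -> nmap f =1 nmap g.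
Proof. by move=> e z; rewrite /nmap (eq_map (eq_map e)) (eq_map e). Qed.

Lemma equiv_nmap n m (f : 'I_n -> 'I_m) (x y : idx n) : equiv x y -> equiv (nmap f x) (nmap f y).
Proof.
move=> /andP[h2 /perm_map_lift [Y hY e]]; rewrite /equiv /= perm_map //=.
apply: perm_trans (perm_map _ (perm_map _ hY)).
suff -> : map (@key m) (map (map f) x.1) = map (@key m) (map (map f) Y) by [].
elim: x.1 Y e {hY h2} => [|s X IH] [|t Y] //= [/eqP + /IH ->]; rewrite key_eq => h.
by congr (_ :: _); apply/eqP; rewrite key_eq perm_map.
Qed.

Lemma equiv_ncat n (x x' y y' : idx n) : equiv x y -> equiv x' y' -> equiv (ncat x x') (ncat y y').
Proof. by move=> /andP[a b] /andP[c d]; rewrite /equiv /= !map_cat !perm_cat. Qed.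

Lemma flatten_uniq_eq (T : eqType) (Q : seq (seq T)) b c h : uniq (flatten Q) ->
  b \in Q -> c \in Q -> h \in b -> h \in c -> b = c.
Proof.
elim: Q => //= a Q IH; rewrite cat_uniq !inE => /and3P[_ /hasPn d uQ].
have {}d e : e \in Q -> h \in e -> h \notin a.
  by move=> he hh; apply: d; apply/flattenP; exists e.
case/orP=> [/eqP ->|hb] /orP[/eqP ->|hc] // h1 h2; last exact: IH.
- by move: (d c hc h2); rewrite h1.
- by move: (d b hb h1); rewrite h2.
Qed.

Section Listing.
Variable N : nat.
Implicit Types (z : seq (seq (HE N)) * seq (HE N)) (G : cgr N).

Definition hset (b : seq (HE N)) : {set HE N} := [set h in b].

(** A graph written in the format of an index, with half-edges for letters: [z.1] lists the internal
    vertices and [z.2] the half-edges of the external ones. A labelling then acts by [nmap], and set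
    partitions are replaced by lists. *)
Definition lgr z : cgr N :=
  ([set B in map hset z.1 ++ [seq [set h] | h <- z.2]], [set B in [seq [set h] | h <- z.2]]).

Definition listing z := ([::] \notin z.1) && perm_eq (nflat z) (enum {: HE N}).

Lemma listing_uniq z : listing z -> uniq (nflat z).
Proof. by case/andP=> _ /perm_uniq ->; rewrite enum_uniq. Qed.

Lemma listing_mem z h : listing z -> h \in nflat z.
Proof. by case/andP=> _ /perm_mem ->; rewrite mem_enum. Qed.

Lemma size_listing z : listing z -> size (nflat z) = N.*2.
Proof.
by case/andP=> _ /perm_size ->; rewrite -cardT card_prod card_ord card_bool muln2.
Qed.

Lemma hset_inj z : listing z -> {in z.1 &, injective hset} /\ uniq z.1.
Proof.
move=> hz; have := listing_uniq hz; rewrite cat_uniq => /andP[+ _].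
case/andP: hz => + _; elim: z.1 => //= b Y IH.
rewrite inE negb_or cat_uniq => /andP[hb hY] /and3P[ub hbY uY].
have [inj uYY] := IH hY uY.
have dis c : c \in Y -> hset b <> hset c.
  move=> hc e; case: b hb hbY e {ub} => [//|h b] _ /hasPn hbY e.
  have : h \in hset c by rewrite -e inE mem_head.
  rewrite inE => hh; have /hbY : h \in flatten Y by apply/flattenP; exists c.
  by rewrite mem_head.
split.
  move=> c d; rewrite !inE => /orP[/eqP -> {c}|hc] /orP[/eqP -> {d}|hd] //.
  - by move=> e; case: (dis _ hd).
  - by move=> e; case: (dis _ hc).
  exact: inj.
by rewrite uYY andbT; apply/negP => /dis.
Qed.

Lemma hset_disj z b h : listing z -> b \in z.1 -> h \in z.2 -> hset b != [set h].
Proof.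
move=> hz hb hh; apply/eqP => e.
have := listing_uniq hz; rewrite cat_uniq => /and3P[_ /hasPn /(_ h hh) /negP[]].
by apply/flattenP; exists b => //; have := set11 h; rewrite -e inE.
Qed.

Lemma lgr_int z : listing z -> (lgr z).1 :\: (lgr z).2 = [set B in map hset z.1].
Proof.
move=> hz; apply/setP => B; rewrite !inE mem_cat.
have [/mapP[h hh ->]|] //= := boolP (B \in [seq [set h] | h <- z.2]); last by rewrite orbF.
by apply/esym/negbTE/negP => /mapP[b hb /esym/eqP]; apply/negP; apply: hset_disj hz _ _.
Qed.

Lemma enum_seqset (T : finType) (s : seq T) : uniq s -> perm_eq (enum [set x in s]) s.
Proof. by move=> u; apply: uniq_perm; rewrite ?enum_uniq // => x; rewrite mem_enum inE. Qed.

(** [Lab] orders vertices and half-edges by [enum]; any other listing gives the same word up to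
    [equiv]. *)
Lemma Lab_lgr n z (l : {ffun 'I_N -> 'I_n}) : listing z ->
  equiv (Lab (lgr z) l) (nmap (fun h => l h.1) z).
Proof.
move=> hz; have [inj uY] := hset_inj hz; have u := listing_uniq hz.
move: (u); rewrite cat_uniq => /and3P[uf _ ut].
apply/andP; split=> /=.
  have -> : map (fun h : HE N => l h.1) z.2 =
     flatten [seq [seq l h.1 | h <- enum B] | B : {set HE N} <- [seq [set h] | h <- z.2]].
    by elim: z.2 => //= h t ->; rewrite enum_set1.
  apply/perm_flatten/perm_map/enum_seqset; rewrite map_inj_uniq //; exact: set1_inj.
rewrite (lgr_int hz); apply: perm_trans (perm_map _ (perm_map _ (enum_seqset _))) _.
  by rewrite map_inj_in_uniq.
rewrite -!map_comp.
suff -> : map (@key n \o (fun B : {set HE N} => [seq l h.1 | h <- enum B]) \o hset) z.1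
   = map (@key n \o map (fun h : HE N => l h.1)) z.1 by [].
apply/eq_in_map => b hb /=; apply/eqP; rewrite key_eq; apply/perm_map/enum_seqset.
by move: uf; elim: z.1 hb => //= c Y IH; rewrite cat_uniq inE => /orP[/eqP ->|/IH h] /and3P[].
Qed.

Lemma tlen_Lab_lgr n z (l : {ffun 'I_N -> 'I_n}) : listing z -> tlen (Lab (lgr z) l) = N.*2.
Proof.
by move=> hz; rewrite (equiv_tlen (Lab_lgr l hz)) -(size_listing hz) -(size_map (fun h => l h.1))
  -nflat_nmap.
Qed.

Lemma lgr_valid z : listing z -> valid (lgr z).
Proof.
move=> hz; have u := listing_uniq hz; apply/and3P; split.
- apply/and3P; split.
  + apply/eqP/setP => h; rewrite inE; apply/bigcupP.
    have := listing_mem h hz; rewrite mem_cat => /orP[/flattenP[b hb hh]|hh].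
      by exists (hset b); rewrite ?inE // mem_cat map_f.
    by exists [set h]; rewrite ?inE // mem_cat [X in _ || X]map_f ?orbT.
  (* All vertices as lists of half-edges, external ones as singletons, so that disjointness follows
     from [uniq (flatten Q)]. *)
  + pose Q := z.1 ++ [seq [:: h] | h <- z.2].
    have uQ : uniq (flatten Q) by rewrite flatten_cat flatten_seq1.
    have inQ A : A \in (lgr z).1 -> exists2 b, b \in Q & A = hset b.
      rewrite inE mem_cat => /orP[/mapP[b hb ->]|/mapP[h hh ->]].
        by exists b; rewrite ?mem_cat ?hb.
      exists [:: h]; first by rewrite mem_cat [X in _ || X]map_f ?orbT.
      by apply/setP => k; rewrite !inE.
    apply/trivIsetP => A B /inQ[b hb ->] /inQ[c hc ->]; apply: contraR.
    case/pred0Pn => h /andP[/=]; rewrite !inE => h1 h2; rewrite (flatten_uniq_eq uQ hb hc h1 h2).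
    by [].
  rewrite inE mem_cat negb_or; apply/andP; split; apply/negP => /mapP[b hb /setP].
    case: b hb => [|h b] hb; first by case/andP: hz; rewrite hb.
    by move/(_ h); rewrite !inE eqxx.
  by move/(_ b); rewrite !inE eqxx.
- by apply/subsetP => B; rewrite !inE mem_cat orbC => ->.
by apply/forall_inP => B; rewrite inE => /mapP[h _ ->]; rewrite cards1.
Qed.

Lemma valid_lgr G : valid G -> exists2 z, listing z & G = lgr z.
Proof.
case: G => P E /and3P[/= hP hE /forall_inP h1].
pose z := ([seq enum B | B : {set HE N} <- enum (P :\: E)],
  flatten [seq enum B | B : {set HE N} <- enum E]).
have e2 : [seq [set h] | h <- z.2] = enum E.
  rewrite /z /=; have : {in enum E, forall B : {set HE N}, #|B| == 1%N} by move=> B;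
    rewrite mem_enum; apply: h1.
  elim: (enum E) => //= B s IH hs; rewrite map_cat IH; last first.
    by move=> C hC; apply: hs; rewrite inE hC orbT.
  by have /cards1P[h ->] := hs B (mem_head _ _); rewrite enum_set1.
have e1 : map hset z.1 = enum (P :\: E).
  rewrite -map_comp -[RHS]map_id; apply: eq_map => B /=.
  by apply/setP => h; rewrite inE mem_enum.
have [cP tP nP] := and3P hP.
exists z; last first.
  rewrite /lgr e1 e2; congr (_, _); apply/setP => B; rewrite inE ?mem_cat !mem_enum // !inE.
  by case hB: (B \in E) => //=; rewrite ?orbT ?orbF // (subsetP hE).
apply/andP; split.
  apply/mapP => -[B]; rewrite mem_enum inE => /andP[_ hB] /esym e.
  by case/negP: nP; suff <- : B = set0 by []; apply/setP => h; rewrite -mem_enum e inE.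
(* A half-edge is counted once per block that contains it, and in a partition this is exactly one
   block. *)
have cnt h : count_mem h (nflat z) = 1%N.
  rewrite /nflat /z /= -flatten_cat -map_cat count_flatten -map_comp sumnE big_map.
  have -> : (\sum_(B <- enum (P :\: E) ++ enum E) ((count_mem h) \o (fun B : {set HE N} => enum
    B)) B
     = \sum_(B in P) (h \in B))%N.
    rewrite -[RHS]big_enum /=.
    have hp : perm_eq (enum (P :\: E) ++ enum E) (enum P).
      apply: uniq_perm; rewrite ?enum_uniq //.
        rewrite cat_uniq !enum_uniq andbT; apply/hasPn => B; rewrite !mem_enum => hB.
        by rewrite inE hB.
      move=> B; rewrite mem_cat !mem_enum inE; case hB: (B \in E) => //=; rewrite ?orbF //.
      by rewrite (subsetP hE).
    rewrite (perm_big _ hp) /=; apply: eq_bigr => B _.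
    by rewrite count_uniq_mem ?enum_uniq // mem_enum.
  have hh : h \in cover P by rewrite (eqP cP) inE.
  rewrite (bigD1 (pblock P h)) ?pblock_mem //= mem_pblock hh big1 // => B /andP[hB nB].
  by apply/eqP; rewrite eqb0; apply: contra nB => hB'; rewrite (def_pblock tP hB hB').
apply: uniq_perm => [||h]; rewrite ?enum_uniq //; last first.
  by rewrite mem_enum -has_pred1 has_count cnt.
by apply: count_mem_uniq => h; rewrite cnt -has_pred1 has_count cnt.
Qed.

(** An equivalence with a labelled listing becomes an equality once the listing is reordered, and
    reordering leaves the graph unchanged. *)
Lemma equiv_rearrange n (A : eqType) (f : A -> 'I_n) (g : HE N -> 'I_n) y z :
  equiv (nmap f y) (nmap g z) -> listing z ->
  exists z', [/\ listing z', lgr z' = lgr z & nmap f y = nmap g z'].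
Proof.
move=> /andP[/= /perm_map_lift [t ht e2] /nested_lift [X1 [X2 [h1 h2 e1]]]] /andP[hn hp].
have pf : perm_eq (flatten X2) (flatten z.1).
  apply: perm_trans (perm_flatten h1);
    elim: X2 X1 h2 {h1 e1} => [|a X2 IH] [|b X1] //= /andP[ha /IH hb].
  exact: perm_cat.
have es : map hset X2 = map hset X1.
  elim: X2 X1 h2 {h1 e1 pf} => [|a X2 IH] [|b X1] //= /andP[ha /IH ->]; congr (_ :: _).
  by apply/setP => h; rewrite !inE (perm_mem ha).
exists (X2, t); split.
- apply/andP; split=> /=; last by apply: perm_trans hp; apply: perm_cat.
  apply: contra hn; rewrite -(perm_mem h1).
  elim: X2 X1 h2 {h1 e1 pf es} => [|a X2 IH] [|b X1] //= /andP[ha /IH hb].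
  rewrite !inE => /orP[/eqP ea|/hb ->]; last by rewrite orbT.
  by rewrite -ea in ha; have := perm_size ha; case: (b).
- rewrite /lgr /= es; congr (_, _); apply/setP => B; rewrite !inE ?mem_cat.
    by rewrite (perm_mem (perm_map hset h1)) (perm_mem (perm_map _ ht)).
  by rewrite (perm_mem (perm_map _ ht)).
by rewrite /nmap /= e1 e2.
Qed.

End Listing.

Lemma mapG_lgr a b (f : HE a -> HE b) z : mapG f (lgr z) = lgr (nmap f z).
Proof.
have e2 (B : {set HE b}) : (B \in [set f @: C | C : {set HE a} in [set B in [seq [set h] | h <-
  z.2]]])
    = (B \in [seq [set h] | h <- map f z.2]).
  apply/imsetP/mapP => [[C + ->]|[h /mapP[k hk ->] ->]].
    by rewrite inE => /mapP[h hh ->]; exists (f h); rewrite ?map_f ?imset_set1.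
  by exists [set k]; rewrite ?imset_set1 // inE; apply/mapP; exists k.
congr (_, _); apply/setP => B; rewrite [RHS]inE ?e2 // mem_cat -e2.
apply/imsetP/orP => [[C + ->]|[/mapP[s /mapP[t ht ->] ->]|/imsetP[C hC ->]]].
- rewrite inE mem_cat => /orP[/mapP[t ht ->]|hC]; [left|right].
    apply/mapP; exists (map f t); first exact: map_f.
    apply/setP => h; rewrite inE; apply/imsetP/mapP => -[k hk ->]; exists k => //; by move: hk;
      rewrite inE.
  by apply: imset_f; rewrite inE.
- exists (hset t); first by rewrite inE mem_cat map_f.
  apply/setP => h; rewrite inE; apply/mapP/imsetP => -[k hk ->]; exists k => //; by move: hk;
    rewrite inE.
by exists C => //; move: hC; rewrite !inE mem_cat orbC => ->.
Qed.

Lemma listing_perm N (s : {perm HE N}) z : listing z -> listing (nmap s z).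
Proof.
move=> hz; apply/andP; split.
  by case/andP: hz => + _; apply: contra => /mapP[[|//] h].
rewrite nflat_nmap; apply: uniq_perm; rewrite ?enum_uniq ?map_inj_uniq ?listing_uniq //;
  try exact: perm_inj.
move=> h; rewrite mem_enum; apply/mapP; exists (s^-1%g h); first exact: listing_mem.
by rewrite permKV.
Qed.

(** After rearrangement both listings spell the same word, so sending one listing to the other entry
    by entry preserves labels and vertices. Whether edges are preserved depends on the
    labellings. *)
Lemma lgr_iso N n (l l' : HE N -> 'I_n) (z z' : seq (seq (HE N)) * seq (HE N)) :
  listing z -> listing z' -> equiv (nmap l z) (nmap l' z') ->
  exists2 s : {perm HE N}, mapG s (lgr z) = lgr z' & forall h, l' (s h) = l h.
Proof.
move=> hz hz' /equiv_rearrange /(_ hz') [w [hw ew e]].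
have /andP[_ p1] := hz; have /andP[_ p2] := hw.
have [s hs] := perm_from_lists p1 p2; exists s.
  rewrite mapG_lgr -ew; congr lgr.
  have sh : shape (map (map s) z.1) = shape w.1.
    by have [/(congr1 shape) + _] := e; rewrite !shape_nmap.
  have hs' : nflat (nmap s z) = nflat w by rewrite nflat_nmap.
  rewrite [LHS]surjective_pairing [RHS]surjective_pairing; congr (_, _).
    by rewrite -(reshape_flatten w.1 w.2) -sh -[X in reshape _ X]/(nflat w) -hs' reshape_flatten.
  rewrite -(drop_size_cat w.2 (erefl (size (flatten w.1)))) -[X in drop _ X]/(nflat w) -hs'.
  by rewrite size_flatten -sh -size_flatten drop_size_cat.
move=> h; have : map l (nflat z) = map l' (map s (nflat z)) by rewrite hs -!nflat_nmap e.
rewrite -map_comp => /eq_in_map /(_ h (listing_mem h hz)) -> //.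
Qed.

(** * Isomorphism and invariance of Phi *)

Section Iso.
Variable N : nat.
Implicit Types (s t : {perm HE N}) (G H : cgr N).

Lemma isobyE s G H : isoby s G H = edgepres s && (mapG s G == H).
Proof. by rewrite /isoby /mapG; case: H => P E; rewrite xpair_eqE. Qed.

Lemma edgepresP s :
  reflect (exists p : {perm 'I_N}, forall h, (s h).1 = p h.1) (edgepres s).
Proof.
apply: (iffP forallP) => [es|[p hp] h]; last by rewrite !hp.
have es' e b : (s (e, b)).1 = (s (e, false)).1.
  by case: b => //; rewrite [LHS](eqP (es (e, true))).
(* [q] is a right inverse of the map induced on edges; by finiteness it is a permutation, and its
   inverse is the one sought. *)
pose q e := (s^-1%g (e, false)).1.
have qK : cancel q (fun e => (s (e, false)).1).
  by move=> e; rewrite /q -(es' _ (s^-1%g (e, false)).2) -surjective_pairing permKV.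
exists (perm (can_inj qK))^-1%g => -[e b]; rewrite es' /=.
by rewrite -{1}(permKV (perm (can_inj qK)) e) permE qK.
Qed.

Lemma mapG_comp a b c (f : HE b -> HE c) (g : HE a ->
  HE b) (G : cgr a) : mapG f (mapG g G) = mapG (f \o g) G.
Proof.
rewrite /mapG /=; congr (_, _); rewrite -imset_comp; apply: eq_imset => B /=;
  by rewrite -imset_comp.
Qed.

Lemma eq_mapG a b (f g : HE a -> HE b) : f =1 g -> mapG f =1 mapG g.
Proof. by move=> e G; rewrite /mapG; congr (_, _); apply: eq_imset => B; apply: eq_imset. Qed.

Lemma mapG_id a (G : cgr a) : mapG id G = G.
Proof.
case: G => P E; rewrite /mapG /=; congr (_, _); rewrite -[RHS]imset_id; apply: eq_imset => B;
  exact: imset_id.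
Qed.

Lemma edgepresV s : edgepres s -> edgepres s^-1%g.
Proof.
case/edgepresP=> p hp; apply/edgepresP; exists p^-1%g => h.
by rewrite -{2}(permKV s h) hp permK.
Qed.

Lemma edgepresM s t : edgepres s -> edgepres t -> edgepres (s * t)%g.
Proof.
case/edgepresP=> p hp /edgepresP[q hq]; apply/edgepresP; exists (p * q)%g => h.
by rewrite !permM hq hp.
Qed.

Lemma isobyV s G H : isoby s G H -> isoby s^-1%g H G.
Proof.
rewrite !isobyE => /andP[/edgepresV -> /eqP <-] /=; rewrite mapG_comp.
by rewrite (@eq_mapG _ _ _ id) ?mapG_id // => h /=; rewrite permK.
Qed.

Lemma isobyM s t G H G' : isoby s G H -> isoby t H G' -> isoby (s * t)%g G G'.
Proof.
rewrite !isobyE => /andP[es /eqP <-] /andP[et /eqP <-]; rewrite edgepresM //= mapG_comp.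
by apply/eqP/eq_mapG => h; rewrite permM.
Qed.

Lemma iso_refl G : iso G G.
Proof.
apply/existsP; exists 1%g; rewrite isobyE (@eq_mapG _ _ _ id) ?mapG_id ?eqxx ?andbT.
  by apply/forallP => h; rewrite !perm1.
by move=> h; rewrite perm1.
Qed.

Lemma iso_sym G H : iso G H = iso H G.
Proof. by apply/existsP/existsP => -[s /isobyV h]; exists s^-1%g. Qed.

Lemma iso_trans G H G' : iso G H -> iso H G' -> iso G G'.
Proof.
by case/existsP=> s hs /existsP[t ht]; apply/existsP; exists (s * t)%g; apply: isobyM hs ht.
Qed.

Lemma iso_valid G H : iso G H -> valid G -> valid H.
Proof.
case/existsP=> s; rewrite isobyE => /andP[_ /eqP <-] /valid_lgr[z hz ->].
by rewrite mapG_lgr; apply/lgr_valid/listing_perm.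
Qed.

Lemma orb_iso G H : iso G H -> orb G = orb H.
Proof.
move=> h; apply: eq_card => G'; rewrite !inE; congr (_ && _).
by apply/idP/idP; apply: iso_trans => //; rewrite iso_sym.
Qed.

Lemma orb_gt0 G : valid G -> (0 < orb G)%N.
Proof. by move=> vG; apply/card_gt0P; exists G; rewrite inE vG iso_refl. Qed.

Lemma Lab_iso n s (p : {perm 'I_N}) G (l : {ffun 'I_N -> 'I_n}) : valid G ->
  (forall h, (s h).1 = p h.1) -> equiv (Lab (mapG s G) l) (Lab G [ffun e => l (p e)]).
Proof.
move=> /valid_lgr[z hz ->] hp; rewrite mapG_lgr.
apply: equiv_trans (Lab_lgr l (listing_perm s hz)) _; rewrite equiv_sym nmap_comp.
rewrite (@eq_nmap _ _ _ (fun h : HE N => [ffun e => l (p e)] h.1)); first exact: Lab_lgr.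
by move=> h; rewrite /= ffunE hp.
Qed.

End Iso.

Lemma tlen_Lab N n (G : cgr N) (l : {ffun 'I_N -> 'I_n}) : valid G -> tlen (Lab G l) = N.*2.
Proof. by move=> /valid_lgr[z hz ->]; apply: tlen_Lab_lgr. Qed.

Lemma mem_Lab N n (G : cgr N) (l : {ffun 'I_N -> 'I_n}) e : valid G -> l e \in nflat (Lab G l).
Proof.
move=> /valid_lgr[z hz ->]; rewrite (perm_mem (equiv_flat (Lab_lgr l hz))) -/(nflat _) nflat_nmap.
by apply/mapP; exists (e, true) => //; apply: listing_mem.
Qed.

Lemma nil_Lab N n (G : cgr N) (l : {ffun 'I_N -> 'I_n}) : valid G -> [::] \notin (Lab G l).1.
Proof.
move=> /valid_lgr[z hz ->]; rewrite (equiv_nil (Lab_lgr l hz)); apply/mapP => -[[|//] h _].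
by case/andP: hz; rewrite h.
Qed.

Lemma big_inj_support (V : nmodType) (I J : finType) (f : I -> J) (F : J -> V) : injective f ->
  (forall j, F j != 0 -> exists i, j = f i) -> \sum_j F j = \sum_i F (f i).
Proof.
move=> fI h; rewrite (bigID (mem (codom f))) /= [X in _ + X]big1 ?addr0 => [|j]; last first.
  by apply: contraNeq => /h [i ->]; apply: codom_f.
rewrite -(big_imset F (in2W fI)) /=; apply: eq_bigl => j; apply/idP/imsetP.
  by move/codomP=> [i ->]; exists i.
by case=> i _ ->; apply: codom_f.
Qed.

(** * The image of Phi lies in the inverse limit *)

Section PhiG_linf.
Variable K : fieldType.
Hypothesis hK : [pchar K] =i pred0.

Lemma nper_expand (A B : eqType) (y : seq (seq A) * seq A) (x : seq (seq B) * seq B) :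
  exists2 L : seq (seq B), {in L, forall s, perm_eq s (nflat x) && (size s == size (nflat y))} &
  forall r : A -> B -> K, nper r y x = \sum_(s <- L) \prod_(z <- zip (nflat y) s) r z.1 z.2.
Proof.
have [L1 h1 e1] := per_per_expand K y.1 x.1; have [L2 h2 e2] := per_expand K y.2 x.2.
exists [seq s ++ t | s <- L1, t <- L2].
  move=> s /allpairsP[[s1 s2] /= [/h1/andP[a3 b3] /h2/andP[a2 b2] ->]].
  by rewrite !size_cat (eqP b3) (eqP b2) eqxx andbT perm_cat.
move=> r; rewrite big_allpairs_dep /nper /= e1 e2 big_distrl /=;
  apply: eq_big_seq => s /h1/andP[_ /eqP hs].
by rewrite big_distrr /=; apply: eq_bigr => t _; rewrite zip_cat // big_cat.
Qed.

(** The stabiliser count divides [ngroup], which is nonzero in characteristic zero. *)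
Lemma nperd_neq0 n (y x : idx n) : (nperd K y x != 0) = equiv y x.
Proof.
have := ngroup_neq0 hK x; rewrite -orbsize_nperd mulf_eq0 negb_or => /andP[_ h].
by rewrite nperd_equiv mulf_eq0 (negPf h) orbF; case: equiv; rewrite ?oner_eq0 ?eqxx.
Qed.

Lemma nperd_nmap n m (f : 'I_n -> 'I_m) (y x : idx n) : injective f ->
  nperd K (nmap f y) (nmap f x) = nperd K y x.
Proof.
move=> fI; rewrite /nperd nper_nmap /nper; congr (_ * _); last first.
  by apply: eq_per => a b; rewrite /kdelta inj_eq.
by do 2 (apply: eq_per => ? ?); rewrite /kdelta inj_eq.
Qed.

Lemma equiv_nmap_inj n m (f : 'I_n -> 'I_m) (y x : idx n) : injective f ->
  equiv (nmap f y) (nmap f x) = equiv y x.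
Proof. by move=> fI; rewrite -!nperd_neq0 nperd_nmap. Qed.

Lemma ngroup_shape n m (x : idx n) (y : idx m) : shape x.1 = shape y.1 -> size x.2 = size y.2 ->
  ngroup K x = ngroup K y.
Proof.
move=> h1 h2; rewrite /ngroup h2 -!(size_map size) -!/(shape _) h1; congr (_ * _ * _).
by rewrite -!(big_map size xpredT (fun m => m`!%:R)) -!/(shape _) h1.
Qed.

Lemma PhiG_equiv N n (G : cgr N) (x y : idx n) : equiv x y -> PhiG n G x = PhiG n G y :> K.
Proof.
move=> h; rewrite !PhiG_sum (equiv_orbsize h); apply: eq_bigr => l _; congr (_%:R / _).
by rewrite (equiv_eql h).
Qed.

Lemma PhiG_iso N n (G G' : cgr N) (x : idx n) : valid G -> iso G G' ->
  PhiG n G x = PhiG n G' x :> K.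
Proof.
move=> vG /existsP[s]; rewrite isobyE => /andP[/edgepresP[p hp] /eqP <-].
rewrite !PhiG_sum.
rewrite (reindex (fun l : {ffun 'I_N -> 'I_n} => [ffun e => l (p e)])) /=; last first.
  exists (fun l : {ffun 'I_N -> 'I_n} => [ffun e => l (p^-1%g e)]) => l _; apply/ffunP => e;
    rewrite !ffunE.
    by rewrite permKV.
  by rewrite permK.
by apply: eq_bigr => l _; rewrite -(equiv_eqr (Lab_iso l vG hp)).
Qed.

Lemma PhiG0 N n (G : cgr N) (x : idx n) : valid G -> tlen x != N.*2 -> PhiG n G x = 0 :> K.
Proof.
move=> vG h; rewrite PhiG_sum big1 // => l _.
by case e: equiv; rewrite ?mul0r //; move: h; rewrite -(equiv_tlen e) tlen_Lab ?eqxx.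
Qed.

Lemma PhiG_nil N n (G : cgr N) (x : idx n) : valid G -> [::] \in x.1 -> PhiG n G x = 0 :> K.
Proof.
move=> vG h; rewrite PhiG_sum big1 // => l _.
by case e: equiv; rewrite ?mul0r //; move: h; rewrite -(equiv_nil e) (negPf (nil_Lab l vG)).
Qed.

Lemma orbsize_nmap n m (f : 'I_n -> 'I_m) (x : idx n) : injective f ->
  (orbsize (nmap f x))%:R = (orbsize x)%:R :> K.
Proof.
move=> fI; have h : nperd K x x != 0 by rewrite nperd_neq0 equiv_refl.
apply: (mulIf h); rewrite orbsize_nperd -(nperd_nmap x x fI) orbsize_nperd.
by apply: ngroup_shape; rewrite ?shape_nmap ?size_map.
Qed.

(** Every edge label occurs in the word, so a labelling that matches [nmap f x] takes its values in
    the image of [f] and lifts. *)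
Lemma PhiG_nmap N n m (f : 'I_n -> 'I_m) (G : cgr N) (x : idx n) : injective f -> valid G ->
  PhiG m G (nmap f x) = PhiG n G x :> K.
Proof.
move=> fI vG; rewrite !PhiG_sum (orbsize_nmap x fI).
pose F (l : {ffun 'I_N -> 'I_n}) : {ffun 'I_N -> 'I_m} := [ffun e => f (l e)].
have eL l : Lab G (F l) = nmap f (Lab G l).
  rewrite /Lab /nmap /= map_flatten -!map_comp; congr (_, flatten _);
  apply: eq_map => B /=; rewrite -map_comp; by apply: eq_map => h; rewrite /= ffunE.
rewrite (@big_inj_support _ _ _ F).
- by apply: eq_bigr => l _; rewrite eL equiv_nmap_inj.
- by move=> l l' /ffunP h; apply/ffunP => e; apply: fI; have := h e; rewrite !ffunE.
move=> l; case e: equiv; rewrite ?mul0r ?eqxx // => _.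
have h i : exists c, l i == f c.
  have := mem_Lab l i vG; rewrite (perm_mem (equiv_flat e)) -/(nflat _) nflat_nmap => /mapP[c _ ->].
  by exists c.
by exists [ffun i => xchoose (h i)]; apply/ffunP => i; rewrite /F !ffunE;
  exact: (eqP (xchooseP (h i))).
Qed.

Definition unflat (A B : Type) (x : seq (seq A) * seq A) (w : seq B) :=
  (reshape (shape x.1) w, drop (size (flatten x.1)) w).

Lemma unflat_map (A B : Type) (f : A -> B) x : unflat x (map f (nflat x)) = nmap f x.
Proof.
rewrite /unflat -nflat_nmap /nmap /nflat /= -{1}(shape_nmap f) reshape_flatten.
by rewrite size_flatten -(shape_nmap f) -size_flatten drop_size_cat.
Qed.

Lemma reshape_map (A B : Type) (f : A ->
  B) sh s : reshape sh (map f s) = map (map f) (reshape sh s).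
Proof. by elim: sh s => //= k sh IH s; rewrite -map_take -map_drop IH. Qed.

Lemma nmap_unflat (A B C : Type) (f : B -> C) (x : seq (seq A) * seq A) s :
  unflat x (map f s) = nmap f (unflat x s).
Proof. by rewrite /unflat /nmap reshape_map map_drop. Qed.

Lemma flat_reshape (A B : Type) (x : seq (seq A) * seq A) (w : seq B) : size w = size (nflat x) ->
  shape (unflat x w).1 = shape x.1 /\ nflat (unflat x w) = w.
Proof.
rewrite size_cat size_flatten => h; rewrite /unflat /nflat /= size_flatten.
have h' : (sumn (shape x.1) <= size w)%N by rewrite h leq_addr.
elim: (shape x.1) w h' {h} => [|k sh IH] w /=; first by rewrite drop0.
move=> h; have hk : (k <= size w)%N by lia.
have [|e1 e2] := IH (drop k w); first by rewrite size_drop; lia.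
rewrite e1 size_take_min (minn_idPl hk); split=> //.
by rewrite addnC -drop_drop -catA e2 cat_take_drop.
Qed.

Lemma zip_map2 (A B C : Type) (f : A -> B) (g : A -> C) s :
  zip (map f s) (map g s) = [seq (f a, g a) | a <- s].
Proof. by elim: s => //= a s ->. Qed.

Lemma prod_zip_tuple (A B : Type) d (F : A -> B -> K) (s : d.-tuple A) (t : d.-tuple B) :
  \prod_(u <- zip s t) F u.1 u.2 = \prod_(i < d) F (tnth s i) (tnth t i).
Proof.
by rewrite -{1}(map_tnth_enum s) -{1}(map_tnth_enum t) zip_map2 big_map big_enum.
Qed.

(** For each bijection of half-edges with slots, acting by [g] puts a factor [g] on both halves of
    every edge. Summing over the label of the edge gives an entry of [g *m g^T = 1], the same as for
    the identity matrix. *)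
Lemma PhiG_actO N n (G : cgr N) (g : 'M[K]_n) x : valid G -> g^T *m g = 1%:M ->
  actO g (PhiG n G) x = PhiG n G x.
Proof.
move=> /valid_lgr[z hz ->] /mulmx1C hg; rewrite /actO /= -/(nflat x).
(* [x0] has the slot numbers for letters, so every word of this shape is an image of it under
   [nmap]. *)
set d := size (nflat x); pose x0 := unflat x (enum 'I_d).
have dsz : size (enum 'I_d) = d by rewrite size_enum_ord.
have [L hL eL] := nper_expand z x0.
pose S (w : 'I_d -> 'I_n) := \sum_(s <- L) \sum_(l : {ffun 'I_N -> 'I_n})
  \prod_(u <- zip (nflat z) s) (l u.1.1 == w u.2)%:R : K.
have ux0 (w : d.-tuple 'I_n) : unflat x w = nmap (tnth w) x0.
  by rewrite -nmap_unflat map_tnth_enum.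
have PhiS (w : d.-tuple 'I_n) : PhiG n (lgr z) (unflat x w) = S (tnth w) / ngroup K x.
  rewrite (PhiG_nper hK); congr (_ / _); last first.
    rewrite ux0; have [h1 h2] := @flat_reshape _ _ x (enum 'I_d) dsz.
    apply: ngroup_shape; rewrite ?shape_nmap ?h1 //.
    by rewrite /= size_map size_drop dsz /d size_cat addKn.
  rewrite /S exchange_big; apply: eq_bigr => l _.
  rewrite nperd_equiv (equiv_eqr (Lab_lgr l hz)) -nperd_equiv ux0 /nperd nper_nmap eL.
  by apply: eq_bigr => s _.
have -> : PhiG n (lgr z) x = S (tnth (in_tuple (nflat x))) / ngroup K x.
  rewrite -PhiS; congr (PhiG _ _ _).
  by rewrite -[LHS]nmap_id -unflat_map map_id.
pose a := tnth (in_tuple (nflat x)).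
transitivity ((\sum_(w : d.-tuple 'I_n) (\prod_(p < d) g (a p) (tnth w p)) * S (tnth w)) / ngroup
  K x).
  rewrite big_distrl /=; apply: eq_bigr => w _.
  by rewrite -mulrA -PhiS -(prod_zip_tuple _ (in_tuple (nflat x)) w).
congr (_ / _); under eq_bigr do rewrite big_distrr /=.
rewrite exchange_big /=; apply: eq_big_seq => s /hL /andP[ps /eqP ss].
have [_ ex0] := @flat_reshape _ _ x (enum 'I_d) dsz.
rewrite /x0 ex0 in ps.
(* The rearrangement [s] is read as a bijection [f] from half-edges to slots. *)
have /andP[_ pz] := hz; have [f [f' fK f'K] <-] := bij_from_lists pz ps (esym ss).
have prodE (F : HE N -> 'I_d -> K) :
    \prod_(u <- zip (nflat z) (map f (nflat z))) F u.1 u.2 = \prod_h F h (f h).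
  by rewrite -{1}(map_id (nflat z)) zip_map2 big_map (perm_big _ pz) big_enum.
pose T (r : 'M[K]_n) := \sum_(l : {ffun 'I_N -> 'I_n}) \prod_(h : HE N) r (a (f h)) (l h.1).
(* The product over edges of sums over one label; each sum is an entry of [r *m r^T]. *)
have TE (r : 'M[K]_n) : r *m r^T = 1%:M ->
    T r = \prod_(e < N) (a (f (e, true)) == a (f (e, false)))%:R.
  move=> hr; transitivity (\prod_(e < N) \sum_(c < n) r (a (f (e, true))) c * r (a (f (e,
    false))) c).
    rewrite bigA_distr_bigA /T; apply: eq_bigr => l _.
    rewrite [RHS](eq_bigr (fun e => \prod_(b : bool) r (a (f (e, b))) (l e))).
      by rewrite pair_bigA; apply: eq_bigr => -[e b] _.
    by move=> e _; rewrite big_bool.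
  apply: eq_bigr => e _.
  have /matrixP /(_ (a (f (e, true))) (a (f (e, false)))) := hr.
  by rewrite !mxE => <-; apply: eq_bigr => c _; rewrite mxE.
transitivity (T g).
  under eq_bigr do rewrite big_distrr /=.
  rewrite exchange_big /=; apply: eq_bigr => l _.
  (* For a given labelling only one word [w] survives, the one that [l] spells through the
     bijection. *)
  rewrite (bigD1 [tuple l (f' p).1 | p < d]) //= [X in _ + X]big1 ?addr0.
    rewrite (prodE (fun h p => (l h.1 == tnth _ p)%:R)) [X in _ * X]big1 ?mulr1.
      rewrite (reindex f) /=; last by exists f' => ? _.
      by apply: eq_bigr => h _; rewrite tnth_mktuple fK.
    by move=> h _; rewrite tnth_mktuple fK eqxx.
  move=> w hw; rewrite (prodE (fun h p => (l h.1 == tnth w p)%:R)).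
  have [p hp] : exists p, tnth w p != l (f' p).1.
    apply/existsP; move: hw; apply: contraR; rewrite negb_exists => /forallP h.
    by apply/eqP/eq_from_tnth => p; rewrite tnth_mktuple; have := h p; rewrite negbK => /eqP.
  by rewrite (bigD1 (f' p)) //= f'K eq_sym (negPf hp) mul0r mulr0.
(* The value of [T] is the same for every orthogonal matrix, and at the identity it is the original
   term. *)
rewrite TE // -(TE 1%:M) ?trmx1 ?mul1mx //; apply: eq_bigr => l _.
rewrite (prodE (fun h p => (l h.1 == a p)%:R)); apply: eq_bigr => h _.
by rewrite mxE eq_sym.
Qed.

Lemma PhiG_linf N (G : cgr N) : valid G -> linf (fun n => PhiG n G : Lfun K n).
Proof.
move=> vG; split=> [n x y|n x|n g hg x|n x].
- exact: PhiG_equiv.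
- exact: PhiG_nil.
- exact: PhiG_actO.
by rewrite -[widenI x]/(nmap _ x) PhiG_nmap // => i j [] /val_inj.
Qed.

Definition PhiHN (f : Hhat K) N n (x : idx n) : K :=
  \sum_(G : cgr N | valid G) f N G / (orb G)%:R * PhiG n G x.

Lemma PhiHN0 f N n (x : idx n) : tlen x != N.*2 -> PhiHN f N x = 0.
Proof. by move=> h; rewrite /PhiHN big1 // => G vG; rewrite PhiG0 ?mulr0. Qed.

(** Only graphs with half as many edges as slots contribute. For an odd number of slots both sides
    vanish. *)
Lemma PhiHE (f : Hhat K) n (x : idx n) : PhiH f n x = PhiHN f (tlen x)./2 x.
Proof.
have h : ((tlen x)./2 < (tlen x).+1)%N by lia.
rewrite /PhiH (bigD1 (Ordinal h)) //= -/(PhiHN _ _ _) big1 ?addr0 // => i hi.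
rewrite -/(PhiHN f i x) PhiHN0 //; apply: contra hi => /eqP e.
by apply/eqP/val_inj; move: e => /=; lia.
Qed.

Lemma tlen_unflat n (x : idx n) (w : (size (nflat x)).-tuple 'I_n) : tlen (unflat x w) = tlen x.
Proof. by have [_ h] := @flat_reshape _ _ x w (size_tuple w);
  rewrite /tlen -/(nflat _) h size_tuple. Qed.

Lemma PhiH_linf (f : Hhat K) : linf (PhiH f).
Proof.
split=> [n x y h|n x h|n g hg x|n x].
- rewrite !PhiHE (equiv_tlen h); apply: eq_bigr => G vG.
  by rewrite (PhiG_equiv _ h).
- by rewrite PhiHE /PhiHN big1 // => G vG; rewrite PhiG_nil ?mulr0.
- rewrite PhiHE /PhiHN /actO.
  under eq_bigr => w _ do rewrite PhiHE (tlen_unflat w) /PhiHN big_distrr /=.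
  rewrite exchange_big /=; apply: eq_bigr => G vG;
    rewrite -[in RHS](PhiG_actO x vG hg) big_distrr /=.
  by apply: eq_bigr => w _; rewrite mulrCA.
rewrite !PhiHE -[widenI x]/(nmap (widen_ord (leqnSn n)) x).
have -> : tlen (nmap (widen_ord (leqnSn n)) x) = tlen x.
  by rewrite /tlen -!/(nflat _) nflat_nmap size_map.
by apply: eq_bigr => G vG; rewrite PhiG_nmap // => i j [] /val_inj.
Qed.

End PhiG_linf.

(** * Stable invariants are determined by pairing words *)

Definition idl N : {ffun 'I_N -> 'I_N} := [ffun e => e].

(** Distinct letters on the edges of [G0] record which half-edges belong together, so the
    permutation given by [lgr_iso] preserves edges. *)
Lemma Lab_idl_iso N (G G0 : cgr N) l : valid G -> valid G0 ->
  equiv (Lab G l) (Lab G0 (idl N)) -> iso G G0.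
Proof.
move=> /valid_lgr[z hz ->] /valid_lgr[z0 hz0 ->] h.
have : equiv (nmap (fun h : HE N => l h.1) z) (nmap (fun h : HE N => idl N h.1) z0).
  by apply: equiv_trans (Lab_lgr _ hz0); apply: equiv_trans h; rewrite equiv_sym Lab_lgr.
case/(lgr_iso hz hz0) => s es hs; apply/existsP; exists s; rewrite isobyE es eqxx andbT.
have {}hs k : (s k).1 = l k.1 by rewrite -hs ffunE.
by apply/forallP => k; rewrite !hs.
Qed.

Lemma pow345 k : k <> 0%N -> k <> 2%N -> (3 ^ k + 4 ^ k)%N <> (5 ^ k)%N.
Proof.
case: k => [|[|[|k]]] // _ _.
suff : (3 ^ k.+3 + 4 ^ k.+3 < 5 ^ k.+3)%N by lia.
elim: k => // k IH; rewrite !(expnS _ k.+3); lia.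
Qed.

Section Stable.
Variable K : fieldType.
Hypothesis hK : [pchar K] =i pred0.

Lemma natr_inj0 : injective (fun m => m%:R : K).
Proof.
have h m n : (m <= n)%N -> m%:R = n%:R :> K -> m = n.
  move=> le e; apply/eqP; rewrite eqn_leq le -subn_eq0 /= -leqn0 leqNgt.
  by apply/negP => /(natr_neq0 hK); rewrite natrB // e subrr eqxx.
by move=> m n e; case: (leqP m n) => [/h ->|/ltnW /h ->].
Qed.

Lemma PhiG_diag_neq0 N (G : cgr N) : PhiG N G (Lab G (idl N)) != 0 :> K.
Proof.
have := ngroup_neq0 hK (Lab G (idl N)); rewrite -orbsize_nperd mulf_eq0 negb_or => /andP[h1 _].
rewrite mulf_neq0 ?invr_neq0 // natr_neq0 //; apply/card_gt0P; exists (idl N).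
by rewrite inE equiv_refl.
Qed.

Lemma orb_neq0 N (G : cgr N) : valid G -> (orb G)%:R != 0 :> K.
Proof. by move/orb_gt0/(natr_neq0 hK). Qed.

(** On the pairing word of [G] only graphs isomorphic to [G] contribute. There are [orb G] of them
    with equal terms, which cancels the denominator. *)
Lemma PhiH_diag (f : Hhat K) N (G : cgr N) : Hinv f -> valid G ->
  PhiH f N (Lab G (idl N)) = f N G * PhiG N G (Lab G (idl N)).
Proof.
move=> fH vG; rewrite PhiHE tlen_Lab // doubleK /PhiHN.
rewrite (bigID (iso G)) /= [X in _ + X]big1 ?addr0 => [|H /andP[vH nH]]; last first.
  rewrite PhiG_sum big1 ?mulr0 // => l _; case e: equiv; rewrite ?mul0r //.
  by case/negP: nH; rewrite iso_sym; apply: Lab_idl_iso e.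
rewrite (eq_bigr (fun=> f N G / (orb G)%:R * PhiG N G (Lab G (idl N)))).
  rewrite -big_distrl -big_distrr /=; congr (_ * _).
  rewrite big_const iter_addr_0 -[RHS]mulr1 -[X in _ * X]mulr_natl; congr (_ * _).
  rewrite (eq_card (B := [set H | valid H && iso G H])) ?mulfV ?orb_neq0 // => H.
  by rewrite inE.
by move=> H /andP[vH iH]; rewrite -(fH _ G H) // -(orb_iso iH) (PhiG_iso _ _ vG iH).
Qed.

Section Family.
Variables (c : Lfam K) (lc : linf c).
Arguments c : clear implicits.

Lemma linf_sumE n (g : 'M[K]_n) (x : idx n) : g^T *m g = 1%:M ->
  c n x = \sum_(w : (size (nflat x)).-tuple 'I_n)
    (\prod_i g (tnth (in_tuple (nflat x)) i) (tnth w i)) * c n (unflat x w).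
Proof.
case: lc => _ _ act _ hg; rewrite -[LHS](act n g hg x); apply: eq_bigr => w _.
by rewrite -(prod_zip_tuple _ (in_tuple (nflat x)) w).
Qed.

Lemma linf_perm n (p : {perm 'I_n}) x : c n (nmap p x) = c n x.
Proof.
rewrite (@linf_sumE _ (perm_mx p) x); last first.
  by rewrite tr_perm_mx -perm_mxM mulVg perm_mx1.
rewrite (bigD1 (map_tuple p (in_tuple (nflat x)))) //= [X in _ + X]big1 ?addr0.
  by rewrite big1 ?mul1r ?unflat_map // => i _; rewrite !mxE tnth_map eqxx.
move=> w hw; have [i hi] : exists i, p (tnth (in_tuple (nflat x)) i) != tnth w i.
  apply/existsP; move: hw; apply: contraR; rewrite negb_exists => /forallP h.
  by apply/eqP/eq_from_tnth => i; rewrite tnth_map; have := h i; rewrite negbK => /eqP.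
by rewrite (bigD1 i) //= !mxE (negPf hi) !mul0r.
Qed.

(** An injection is a widening followed by a permutation. The former is handled by compatibility
    with the projections, the latter by a permutation matrix. *)
Lemma linf_inj m n (f : 'I_m -> 'I_n) x : injective f -> c n (nmap f x) = c m x.
Proof.
case: lc => _ _ _ wid fI.
have le : (m <= n)%N by have := leq_card f fI; rewrite !card_ord.
have wide k (lek : (m <= k + m)%N) : c (k + m)%N (nmap (widen_ord lek) x) = c m x.
  elim: k lek => [|k IH] lek.
    by congr (c m _); rewrite -[RHS]nmap_id; apply: eq_nmap => i; apply: val_inj.
  rewrite -(IH (leq_addl _ _)) [RHS]wid -[widenI _]/(nmap _ _) nmap_comp.
  apply: (congr1 (c (k + m).+1)).
  by apply: eq_nmap => i; apply: val_inj.
have {wide} hw : c n (nmap (widen_ord le) x) = c m x.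
  by have e := subnK le; move: (le); rewrite -e; apply: wide.
(* Completing both images to enumerations of ['I_n] gives a permutation that carries the widening to
   [f]. *)
pose s1 := map (widen_ord le) (enum 'I_m); pose s2 := map f (enum 'I_m).
have [t1 p1] : exists t, perm_eq (s1 ++ t) (enum 'I_n).
  by apply: perm_extend; rewrite map_inj_uniq ?enum_uniq // => i j [] /val_inj.
have [t2 p2] : exists t, perm_eq (s2 ++ t) (enum 'I_n).
  by apply: perm_extend; rewrite map_inj_uniq ?enum_uniq.
have [p hp] := perm_from_lists p1 p2.
have es : map p s1 = s2.
  move/(congr1 (take (size s2))): hp; rewrite take_size_cat // map_cat take_size_cat //.
  by rewrite !size_map.
rewrite -hw -[RHS](linf_perm p) nmap_comp; congr (c n _); apply: eq_nmap => i.
by move: es; rewrite -map_comp => /eq_in_map /(_ i); rewrite mem_enum => <-.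
Qed.

Lemma prod_if_count (T : eqType) (a : T) (q : K) s :
  \prod_(u <- s) (if u == a then q else 1) = q ^+ count_mem a s.
Proof. by elim: s => [|u s IH]; rewrite ?big_nil ?big_cons //= IH; case: eqP;
  rewrite ?mul1r ?add0n // exprS. Qed.

(* The orthogonal reflection with entries 3/5, 4/5, 4/5, -3/5 in the plane of [a] and [b]. *)
Definition refl345 n (a b : 'I_n) : 'M[K]_n :=
  let v := delta_mx a ord0 - 2%:R *: delta_mx b ord0 : 'cV[K]_n in
  1%:M - (2%:R / 5%:R) *: (v *m v^T).

Lemma refl345E n (a b i j : 'I_n) : refl345 a b i j =
  (i == j)%:R - 2%:R / 5%:R *
    (((i == a)%:R - 2%:R * (i == b)%:R) * ((j == a)%:R - 2%:R * (j == b)%:R)).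
Proof. by rewrite !mxE big_ord1 !mxE !eqxx !andbT. Qed.

Lemma five_neq0 : 5%:R != 0 :> K. Proof. exact: natr_neq0. Qed.

(** A Householder reflection: its normal vector [e_a - 2 e_b] has square length 5, so [M = v v^T]
    satisfies [M^2 = 5 M] and the corrections cancel. *)
Lemma refl345_orth n (a b : 'I_n) : a != b -> (refl345 a b)^T *m refl345 a b = 1%:M.
Proof.
move=> ab; rewrite /refl345; set v : 'cV[K]_n := _ - _.
have vv : v^T *m v = 5%:R%:M.
  apply/matrixP => i j; rewrite !ord1 !mxE (bigD1 a) //= (bigD1 b) 1?eq_sym //= big1 ?addr0.
    rewrite !mxE !eqxx (negPf ab) eq_sym (negPf ab) /=; ring.
  move=> k /andP[ka kb]; rewrite !mxE (negPf ka) (negPf kb) /=; ring.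
set M := v *m v^T.
have MM : M *m M = 5%:R *: M.
  by rewrite /M mulmxA -[v *m v^T *m v]mulmxA vv mul_mx_scalar -scalemxAl.
have Mt : M^T = M by rewrite /M trmx_mul trmxK.
have -> : (1%:M - (2%:R / 5%:R) *: M)^T = 1%:M - (2%:R / 5%:R) *: M.
  by rewrite linearB /= linearZ /= tr_scalar_mx Mt.
rewrite mulmxBl mul1mx mulmxBr mulmx1 -scalemxAl -scalemxAr MM.
rewrite !scalerA -addrA -opprD addrA -scalerDl -scalerBl.
have -> : 2 / 5 + 2 / 5 - 2 / 5 * (2 / 5) * 5 = 0 :> K.
  by have h5 := five_neq0; field.
by rewrite scale0r subr0.
Qed.

Lemma linf_step n (x : idx n) a : a \in nflat x -> count_mem a (nflat x) <> 2%N ->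
  (forall m (y : idx m), size (nflat y) = size (nflat x) ->
     (size (undup (nflat x)) < size (undup (nflat y)))%N -> c m y = 0) ->
  c n x = 0.
Proof.
(* Widening by one provides the letter [b := ord_max], which does not occur in the word. *)
move=> ax ka IH; pose wd := widen_ord (leqnSn n).
have wI : injective wd by move=> i j [] /val_inj.
rewrite -(linf_inj x wI); set x' := nmap wd x.
have ex' : nflat x' = map wd (nflat x) by rewrite nflat_nmap.
pose a' := wd a; pose b : 'I_n.+1 := ord_max.
have bx : b \notin nflat x'.
  by rewrite ex'; apply/mapP => -[i _ /(congr1 val) /= e]; have := ltn_ord i; rewrite -e ltnn.
have ax' : a' \in nflat x' by rewrite ex' map_f.
have ab : a' != b by apply: contraNneq bx => <-.
have {}ka : count_mem a' (nflat x') <> 2%N.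
  by rewrite ex' count_map (@eq_count _ _ (pred1 a)) // => i; rewrite /= inj_eq.
set k := count_mem a' (nflat x') in ka.
have k0 : k <> 0%N by apply/eqP; rewrite -lt0n -has_count has_pred1.
have {}IH (y : idx n.+1) : size (nflat y) = size (nflat x') ->
     (size (undup (nflat x')) < size (undup (nflat y)))%N -> c n.+1 y = 0.
  by rewrite ex' undup_map_inj // !size_map; apply: IH.
pose fl := in_tuple (nflat x'); pose t := tperm a' b.
pose g := refl345 a' b.
have g5 := five_neq0.
have gE u v : u != b -> g u v = if u == a' then (if v == a' then 3%:R / 5%:R else
     if v == b then 4%:R / 5%:R else 0) else (u == v)%:R.
  move=> ub; rewrite /g refl345E (negPf ub).
  have [->|ua] /= := eqVneq u a'; last by rewrite /=; ring.
  have [->|va] := eqVneq v a'; first by rewrite ?eqxx ?(negPf ab) /=; field.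
  by have [_|_] := eqVneq v b; rewrite ?eqxx /=; field.
have flb i : tnth fl i != b by apply: contraNneq bx => <-; apply: mem_tnth.
(* The word with every [a'] replaced by [b] differs from the original because [a'] occurs, so the
   two terms can be split off separately. *)
have sw : map_tuple t fl != fl.
  apply/eqP => e; have : a' \in map_tuple t fl by rewrite e.
  case/mapP=> u hu /(congr1 t); rewrite tpermK tpermL => e'.
  by case/negP: bx; rewrite e'.
have c1 : \prod_i g (tnth fl i) (tnth fl i) = (3%:R / 5%:R) ^+ k.
  rewrite -(big_tuple _ _ fl xpredT (fun u => g u u)) -prod_if_count.
  apply: eq_big_seq => u hu; rewrite gE ?eqxx; last by apply: contraNneq bx => <-.
  by case: eqP.
have c2 : \prod_i g (tnth fl i) (tnth (map_tuple t fl) i) = (4%:R / 5%:R) ^+ k.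
  under eq_bigr do rewrite tnth_map.
  rewrite -(big_tuple _ _ fl xpredT (fun u => g u (t u))) -prod_if_count.
  apply: eq_big_seq => u hu; have ub : u != b by apply: contraNneq bx => <-.
  rewrite gE //; case: eqP => [->|/eqP ua]; first by rewrite tpermL eq_sym (negPf ab) eqxx.
  by rewrite tpermD 1?eq_sym // eqxx.
have := linf_sumE x' (refl345_orth ab); rewrite -/g.
rewrite (bigD1 fl) //= -/fl c1 (bigD1 (map_tuple t fl)) //= c2 big1 ?addr0.
  have -> : unflat x' fl = x' by rewrite -[RHS]nmap_id -unflat_map map_id.
  rewrite unflat_map linf_perm => e.
  have : (5 ^ k)%:R * c n.+1 x' = (3 ^ k + 4 ^ k)%:R * c n.+1 x'.
    rewrite {1}e !natrX natrD !natrX !exprMn !exprVn; field.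
    exact: expf_neq0.
  move/eqP; rewrite -subr_eq0 -mulrBl mulf_eq0 subr_eq0 => /orP[/eqP/natr_inj0 h|/eqP //].
  by case: (pow345 k0 ka).
(* Any other word with a nonzero coefficient replaces some but not all occurrences of [a']. It keeps
   every letter of [x'] and also contains [b], so the induction hypothesis applies. *)
move=> w /andP[w1 w2].
have [z|nz] := eqVneq (\prod_i g (tnth fl i) (tnth w i)) 0; first by rewrite z mul0r.
have hw i : (tnth w i == tnth fl i) || (tnth fl i == a') && (tnth w i == b).
  move/prodf_neq0: nz => /(_ i isT); rewrite gE ?flb //.
  case: (tnth fl i =P a') => [->|_] /=.
    by case: (tnth w i =P a') => //= _; case: (tnth w i =P b) => //= _; rewrite eqxx.
  by have [_|_] := eqVneq (tnth w i) (tnth fl i); rewrite ?eqxx.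
have bw : b \in (w : seq _).
  apply: contraR w1 => nb; apply/eqP/eq_from_tnth => i.
  have /orP[/eqP //|/andP[_ /eqP e]] := hw i.
  by case/negP: nb; rewrite -e mem_tnth.
have aw : a' \in (w : seq _).
  apply: contraR w2 => na; apply/eqP/eq_from_tnth => i; rewrite tnth_map.
  have /orP[/eqP e|/andP[/eqP -> /eqP ->]] := hw i; last by rewrite tpermL.
  by rewrite -e tpermD //; [apply: contraNneq na => ->; apply: mem_tnth|rewrite eq_sym e flb].
rewrite IH ?mulr0 //.
  by have [_ ->] := @flat_reshape _ _ x' w (size_tuple w); rewrite size_tuple.
have [_ ->] := @flat_reshape _ _ x' w (size_tuple w).
apply: (@uniq_leq_size _ (b :: undup (nflat x'))).
  by rewrite /= mem_undup bx undup_uniq.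
move=> u; rewrite inE !mem_undup => /orP[/eqP -> //|/(tnthP fl)[i ->]].
have /orP[/eqP <-|/andP[/eqP -> _] //] := hw i; exact: mem_tnth.
Qed.

End Family.
End Stable.

(** The distinct letters serve as edges, and the two occurrences of a letter as its half-edges. *)
Lemma pairing_word n (x : idx n) : [::] \notin x.1 ->
  {in nflat x, forall a, count_mem a (nflat x) = 2%N} ->
  exists N (G : cgr N) (l : {ffun 'I_N -> 'I_n}), [/\ valid G, injective l & equiv x (Lab G l)].
Proof.
move=> nx h2; pose U := in_tuple (undup (nflat x)); pose N := size (undup (nflat x)).
pose l : {ffun 'I_N -> 'I_n} := [ffun e => tnth U e].
have lI : injective l.
  by move=> i j; rewrite !ffunE => e; apply: (tuple_uniqP U _ i j e); apply: undup_uniq.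
have pe : perm_eq (nflat x) (map (fun h : HE N => l h.1) (enum {: HE N})).
  apply/allP => a _ /=; rewrite count_map; apply/eqP.
  rewrite -[RHS]sum1_count big_enum_cond /=.
  transitivity (\sum_(e < N | l e == a) \sum_(b : bool) 1)%N; last first.
    by rewrite pair_big; apply: eq_bigl => h; rewrite /= andbT.
  have [ha|na] := boolP (a \in nflat x); last first.
    rewrite (count_memPn na) big1 // => e /eqP; rewrite ffunE => e'.
    by case/negP: na; rewrite -e' -mem_undup mem_tnth.
  have /tnthP[e0 e0a] : a \in U by rewrite mem_undup.
  rewrite h2 // (big_pred1 e0) ?big_const ?card_bool // => e /=.
  have -> : a = l e0 by rewrite ffunE.
  exact: inj_eq.
have [u pu eu] := perm_map_lift pe.
pose z := unflat x u.
have zx : nmap (fun h : HE N => l h.1) z = x by rewrite -nmap_unflat -eu -(map_id (nflat x))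
  unflat_map nmap_id.
have su : size u = size (nflat x) by rewrite eu size_map.
have lz : listing z.
  apply/andP; split.
    by apply: contra nx => h; rewrite -zx; apply/mapP; exists [::].
  by rewrite (flat_reshape su).2.
exists N, (lgr z), l; split=> //; first exact: lgr_valid.
by rewrite equiv_sym -[X in equiv _ X]zx; apply: Lab_lgr.
Qed.

(** * Injectivity, surjectivity and the unit *)

Section Bijective.
Variable K : fieldType.
Hypothesis hK : [pchar K] =i pred0.

Lemma Lab_comp N n (G : cgr N) (l : {ffun 'I_N -> 'I_n}) : Lab G l = nmap l (Lab G (idl N)).
Proof.
rewrite /Lab /nmap /= map_flatten -!map_comp; congr (_, flatten _);
apply: eq_map => B /=; rewrite -map_comp; by apply: eq_map => h; rewrite /= ffunE.
Qed.

Lemma linf_vanish (c : Lfam K) : linf c ->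
  (forall N (G : cgr N), valid G -> c N (Lab G (idl N)) = 0) -> forall n (x : idx n), c n x = 0.
Proof.
move=> lc c0 n x; have [ceq cnil _ _] := lc.
(* The measure is the length minus the number of distinct letters; the reflection step keeps the
   former and raises the latter. *)
have [m] := ubnP (size (nflat x) - size (undup (nflat x))); elim: m n x => // m IH n x hm.
have [h2|] := boolP (all (fun a => count_mem a (nflat x) == 2%N) (nflat x)); last first.
  case/allPn => a ax /eqP ka; apply: (linf_step hK lc ax ka) => p y ey sy.
  by apply: IH; rewrite ey; have := size_undup (nflat y); rewrite ey; move: hm sy; clear; lia.
have [/cnil //|nx] := boolP ([::] \in x.1).
have [|N [G [l [vG lI h]]]] := pairing_word nx.
  by move=> a ax; apply/eqP; apply: (allP h2).
by rewrite (ceq _ _ _ h) Lab_comp (linf_inj lc) // c0.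
Qed.

Lemma linf_sub (c c' : Lfam K) : linf c -> linf c' -> linf (fun n x => c n x - c' n x).
Proof.
move=> [a1 a2 a3 a4] [b1 b2 b3 b4]; split=> [n x y h|n x h|n g hg x|n x].
- by rewrite (a1 _ _ _ h) (b1 _ _ _ h).
- by rewrite a2 // b2 // subr0.
- rewrite -(a3 n g hg x) -(b3 n g hg x) /actO -sumrB; apply: eq_bigr => w _; exact: mulrBr.
by rewrite a4 b4.
Qed.

Lemma PhiH_inj (f g : Hhat K) : Hinv f -> Hinv g ->
  (forall n (x : idx n), PhiH f n x = PhiH g n x) ->
  forall N (G : cgr N), valid G -> f N G = g N G.
Proof.
move=> fH gH e N G vG; have := e N (Lab G (idl N)); rewrite !(PhiH_diag hK) //.
exact/mulIf/PhiG_diag_neq0.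
Qed.

Lemma PhiH_surj (c : Lfam K) : linf c ->
  exists f : Hhat K, Hinv f /\ forall n (x : idx n), PhiH f n x = c n x.
Proof.
move=> lc; have [ceq _ _ _] := lc.
(* By [PhiH_diag] this is the only possible value. *)
pose f : Hhat K := fun N G => c N (Lab G (idl N)) / PhiG N G (Lab G (idl N)).
have fH : Hinv f.
  move=> N G H vG iG; rewrite /f.
  have lPhi := PhiG_linf hK vG; have [peq _ _ _] := lPhi.
  rewrite -!(PhiG_iso _ _ vG iG).
  case/existsP: iG => s; rewrite isobyE => /andP[/edgepresP[p hp] /eqP <-].
  (* Pairing words of isomorphic graphs differ by a renaming of letters, under which both [c] and
     [PhiG] are invariant. *)
  have h : equiv (Lab (mapG s G) (idl N)) (nmap p (Lab G (idl N))).
    rewrite (@eq_nmap _ _ p [ffun e => idl N (p e)]) => [|i]; last by rewrite !ffunE.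
    by rewrite -Lab_comp; apply: Lab_iso.
  by rewrite (ceq _ _ _ h) (linf_perm lc) (peq _ _ _ h) (linf_perm lPhi).
exists f; split=> // n x; apply/eqP; rewrite -subr_eq0; apply/eqP.
move: n x; apply: linf_vanish; first exact: linf_sub (PhiH_linf hK f) lc.
by move=> N G vG; rewrite (PhiH_diag hK) // /f divfK ?subrr ?PhiG_diag_neq0.
Qed.

Lemma listing0 : @listing 0 ([::], [::]).
Proof.
by apply/andP; split=> //; rewrite perm_sym; apply/perm_nilP/size0nil;
  rewrite -cardT card_prod card_ord.
Qed.

Lemma valid0 (G : cgr 0) : valid G = (G == lgr ([::], [::])).
Proof.
apply/idP/eqP => [/valid_lgr[[Y t] hz ->]|->]; last exact: lgr_valid listing0.
have /size0nil := size_listing hz; rewrite /nflat /=; case: t hz => [|h t] hz;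
  last by case: (flatten Y).
by case: Y hz => [|[|h b] Y] // /andP[].
Qed.

Lemma equiv_nil2 n (x : idx n) : equiv ([::], [::]) x = (x == ([::], [::])).
Proof.
apply/idP/eqP => [|->]; last exact: equiv_refl.
case: x => [X t] /andP[/= h1 h2].
have /esym/size0nil -> := perm_size h1.
by have /esym/size0nil := perm_size h2; case: X {h2}.
Qed.

Lemma PhiH_unit n (x : idx n) : PhiH (@unitH K) n x = @unitL K n x.
Proof.
rewrite PhiHE /unitL.
have [t0|t0] := posnP (tlen x)./2; last first.
  rewrite /PhiHN big1 => [|G vG]; first by case: eqP => // e; rewrite e in t0.
  by rewrite /unitH eqn0Ngt t0 !mul0r.
rewrite t0 /PhiHN (eq_bigl _ _ valid0) big_pred1_eq /unitH eqxx PhiG_sum.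
have -> : orb (@lgr 0 ([::], [::])) = 1%N.
  apply/eqP/cards1P; exists (lgr ([::], [::])); apply/setP => G; rewrite !inE valid0.
  by case: eqP => // ->; rewrite iso_refl.
rewrite (eq_bigr (fun=> (x == ([::], [::]))%:R / (orbsize x)%:R)); last first.
  move=> l _; congr (_%:R / _); rewrite -equiv_nil2.
  by rewrite (equiv_eqr (Lab_lgr l listing0)).
rewrite big_const card_ffun !card_ord expn0 /= addr0 divr1 mul1r.
case: eqP => [->|_]; last by rewrite mul0r.
have := @orbsize_nperd K n ([::], [::]); rewrite /nperd /nper /ngroup /= !big_nil !mulr1 => ->.
by rewrite divr1.
Qed.

End Bijective.

(** * Product *)

Definition heL a b (h : HE a) : HE (a + b) := (lshift b h.1, h.2).
Definition heR a b (h : HE b) : HE (a + b) := (rshift a h.1, h.2).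

Lemma gunion_lgr a b z1 z2 :
  gunion (@lgr a z1) (@lgr b z2) = lgr (ncat (nmap (@heL a b) z1) (nmap (@heR a b) z2)).
Proof.
rewrite /gunion -/(@heL a b) -/(@heR a b) !mapG_lgr /lgr /ncat /= !map_cat.
by congr (_, _); apply/setP => B; rewrite !inE !mem_cat ?orbA // -!orbA; congr (_ || _);
  rewrite orbCA.
Qed.

Lemma heL_inj a b : injective (@heL a b).
Proof.
by move=> [i c] [j d] e; congr (_, _); [apply: lshift_inj (congr1 fst e)|apply: congr1 snd _ _ e].
Qed.

Lemma heR_inj a b : injective (@heR a b).
Proof.
by move=> [i c] [j d] e; congr (_, _); [apply: rshift_inj (congr1 fst e)|apply: congr1 snd _ _ e].
Qed.

Lemma nflat_ncat (A : eqType) (z z' : seq (seq A) * seq A) :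
  perm_eq (nflat (ncat z z')) (nflat z ++ nflat z').
Proof. by rewrite /nflat /ncat /= flatten_cat -!catA perm_cat2l perm_catCA. Qed.

Lemma nmap_ncat (A B : Type) (f : A -> B) z z' : nmap f (ncat z z') = ncat (nmap f z) (nmap f z').
Proof. by rewrite /nmap /ncat /= !map_cat. Qed.

Lemma listing_gunion a b z1 z2 : @listing a z1 -> @listing b z2 ->
  listing (ncat (nmap (@heL a b) z1) (nmap (@heR a b) z2)).
Proof.
move=> h1 h2; apply/andP; split.
  rewrite mem_cat negb_or; apply/andP; split; apply/mapP => -[[|//] h _].
    by case/andP: h1; rewrite h.
  by case/andP: h2; rewrite h.
rewrite (permPl (nflat_ncat _ _)) !nflat_nmap; apply: uniq_perm; rewrite ?enum_uniq //.
  rewrite cat_uniq (map_inj_uniq (@heL_inj a b)) (map_inj_uniq (@heR_inj a b)) !listing_uniq //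
    andbT /=.
  apply/hasPn => h /mapP[[j d] _ ->]; apply/mapP => -[[i c] _ /(congr1 fst) /= /eqP].
  by rewrite eq_rlshift.
move=> [e c]; rewrite mem_enum mem_cat; apply/orP; case: (split_ordP e) => i ->; [left|right].
  by apply/mapP; exists (i, c) => //; apply: listing_mem.
by apply/mapP; exists (i, c) => //; apply: listing_mem.
Qed.

Lemma gunion_valid a b (G1 : cgr a) (G2 : cgr b) : valid G1 -> valid G2 -> valid (gunion G1 G2).
Proof.
by move=> /valid_lgr[z1 h1 ->] /valid_lgr[z2 h2 ->]; rewrite gunion_lgr;
  apply/lgr_valid/listing_gunion.
Qed.

Lemma Lab_gunion a b n (G1 : cgr a) (G2 : cgr b) (l : {ffun 'I_(a + b) -> 'I_n}) :
  valid G1 -> valid G2 -> equiv (Lab (gunion G1 G2) l)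
    (ncat (Lab G1 [ffun e => l (lshift b e)]) (Lab G2 [ffun e => l (rshift a e)])).
Proof.
move=> /valid_lgr[z1 h1 ->] /valid_lgr[z2 h2 ->]; rewrite gunion_lgr.
apply: equiv_trans (Lab_lgr l (listing_gunion h1 h2)) _; rewrite equiv_sym.
rewrite nmap_ncat !nmap_comp.
apply: equiv_ncat.
  rewrite (eq_nmap (g := fun h : HE a => [ffun e => l (lshift b e)] h.1)); first exact: Lab_lgr.
  by move=> h; rewrite ffunE.
rewrite (eq_nmap (g := fun h : HE b => [ffun e => l (rshift a e)] h.1)); first exact: Lab_lgr.
by move=> h; rewrite ffunE.
Qed.

Definition labcat a b n (p : {ffun 'I_a -> 'I_n} * {ffun 'I_b -> 'I_n}) : {ffun 'I_(a + b) ->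
  'I_n} :=
  [ffun e => match split e with inl i => p.1 i | inr j => p.2 j end].

Lemma labcatL a b n p : [ffun e => @labcat a b n p (lshift b e)] = p.1.
Proof.
apply/ffunP => e; rewrite !ffunE; case: split_ordP => i; first by move/lshift_inj ->.
by move/eqP; rewrite eq_lrshift.
Qed.

Lemma labcatR a b n p : [ffun e => @labcat a b n p (rshift a e)] = p.2.
Proof.
apply/ffunP => e; rewrite !ffunE; case: split_ordP => i; last by move/rshift_inj ->.
by move/eqP; rewrite eq_rlshift.
Qed.

Lemma labcat_bij a b n : bijective (@labcat a b n).
Proof.
exists (fun l : {ffun 'I_(a + b) ->
  'I_n} => ([ffun e => l (lshift b e)], [ffun e => l (rshift a e)])).
  by move=> p; rewrite labcatL labcatR; case: p.
by move=> l; apply/ffunP => e; rewrite !ffunE; case: split_ordP => i -> /=; rewrite ffunE.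
Qed.

Lemma size_msk m (A : {set 'I_m}) : size (msk A) = m.
Proof. by rewrite size_map size_enum_ord. Qed.

Lemma msk_setC m (A : {set 'I_m}) : msk (~: A) = map negb (msk A).
Proof. by rewrite /msk -map_comp; apply: eq_map => i; rewrite /= inE. Qed.

Lemma size_mask_msk (T : Type) (s : seq T) (A : {set 'I_(size s)}) : size (mask (msk A) s) = #|A|.
Proof.
rewrite size_mask ?size_msk // count_map -size_filter cardE; apply/perm_size/uniq_perm.
- by rewrite filter_uniq ?enum_uniq.
- exact: enum_uniq.
by move=> i; rewrite mem_filter !mem_enum andbT.
Qed.

Lemma mem_bits m s : (s \in bits m) = (size s == m).
Proof.
elim: m s => [|m IH] s /=; first by rewrite inE size_eq0.
rewrite mem_cat; case: s => [|c s].
  by apply/negbTE; rewrite negb_or; apply/andP; split; apply/mapP => -[].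
rewrite eqSS -IH; have cI (d : bool) : injective (cons d) by move=> ? ? [].
have nc : (c :: s \in map (cons (~~ c)) (bits m)) = false.
  by apply/negbTE/mapP => -[t _ [+ _]]; case: (c).
by case: c nc => /= ->; rewrite (mem_map (cI _)) ?orbF.
Qed.

Lemma bits_uniq m : uniq (bits m).
Proof.
elim: m => //= m IH; rewrite cat_uniq !map_inj_uniq ?IH //=; try by move=> ? ? [].
by rewrite andbT; apply/hasPn => s /mapP[t _ ->]; apply/mapP => -[].
Qed.

(** Links the subsets in [prodL] with the masks in the Laplace expansion. *)
Lemma sum_msk (V : nmodType) m (F : bitseq -> bitseq -> V) :
  \sum_(A : {set 'I_m}) F (msk A) (msk (~: A)) = \sum_(s <- bits m) F s (map negb s).
Proof.
under eq_bigr do rewrite msk_setC.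
rewrite -(big_map (@msk m) xpredT (fun s => F s (map negb s))).
apply: perm_big; apply: uniq_perm; rewrite ?bits_uniq //.
  rewrite map_inj_uniq ?index_enum_uniq // => A B /eq_in_map e.
  by apply/setP => i; apply: e; rewrite mem_enum.
move=> s; rewrite mem_bits; apply/mapP/eqP => [[A _ ->]|hs]; first exact: size_msk.
exists [set i : 'I_m | nth false s i]; first exact: mem_index_enum.
apply: (@eq_from_nth _ false); rewrite ?size_msk // hs => i hi.
rewrite (nth_map (Ordinal hi)) ?size_enum_ord // inE; congr nth.
exact/esym/nth_enum_ord.
Qed.

Lemma perm_mask_negb (T : eqType) m (s : seq T) : size m = size s ->
  perm_eq (mask m s ++ mask (map negb m) s) s.
Proof.
elim: m s => [|[] m IH] [|a s] //= [/IH h]; first by rewrite perm_cons.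
by rewrite -cat1s perm_catCA /= perm_cons.
Qed.

Section Product.
Variable K : fieldType.
Hypothesis hK : [pchar K] =i pred0.

Lemma nperd_ncat n (y1 y2 x : idx n) : nperd K (ncat y1 y2) x =
  \sum_(A : {set 'I_(size x.1)}) \sum_(B : {set 'I_(size x.2)})
    nperd K y1 (mask (msk A) x.1, mask (msk B) x.2)
    * nperd K y2 (mask (msk (~: A)) x.1, mask (msk (~: B)) x.2).
Proof.
pose d := @kdelta K 'I_n; rewrite /nperd /nper /= !per_Laplace -!/d.
rewrite -(sum_msk _ (fun s t => per (per d) y1.1 (mask s x.1) * per (per d) y2.1 (mask t x.1))).
rewrite -(sum_msk _ (fun s t => per d y1.2 (mask s x.2) * per d y2.2 (mask t x.2))).
rewrite big_distrl /=; apply: eq_bigr => A _; rewrite big_distrr /=; apply: eq_bigr => B _.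
by rewrite mulrACA.
Qed.

(** The source of the binomial coefficients in [prodL]: they compare the group of a word with those
    of its two parts. *)
Lemma ngroup_mask n (x : idx n) (A : {set 'I_(size x.1)}) (B : {set 'I_(size x.2)}) :
  ngroup K x = 'C(size x.1, #|A|)%:R * 'C(size x.2, #|B|)%:R
   * ngroup K (mask (msk A) x.1, mask (msk B) x.2)
   * ngroup K (mask (msk (~: A)) x.1, mask (msk (~: B)) x.2).
Proof.
have fb (T : eqType) (s : seq T) (C : {set 'I_(size s)}) : (size s)`!%:R =
    'C(size s, #|C|)%:R * (size (mask (msk C) s))`!%:R * (size (mask (msk (~: C)) s))`!%:R :> K.
  rewrite !size_mask_msk -!natrM -mulnA; congr _%:R.
  have := max_card (mem C); rewrite card_ord => hC.
  by rewrite [#|~: C|]cardsCs setCK card_ord bin_fact.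
rewrite /ngroup (fb _ x.1 A) (fb _ x.2 B) /=.
rewrite -(perm_big _ (@perm_mask_negb _ (msk A) x.1 (size_msk A))) big_cat -msk_setC /=.
ring.
Qed.

(** Labellings of a disjoint union are pairs of labellings and their words concatenate, so the
    Laplace expansion of [nperd] applies. *)
Lemma PhiG_gunion a b n (G1 : cgr a) (G2 : cgr b) (x : idx n) : valid G1 -> valid G2 ->
  PhiG n (gunion G1 G2) x =
  \sum_(A : {set 'I_(size x.1)}) \sum_(B : {set 'I_(size x.2)})
    ('C(size x.1, #|A|)%:R)^-1 * ('C(size x.2, #|B|)%:R)^-1 *
    PhiG n G1 (mask (msk A) x.1, mask (msk B) x.2) *
    PhiG n G2 (mask (msk (~: A)) x.1, mask (msk (~: B)) x.2) :> K.
Proof.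
move=> v1 v2; rewrite (PhiG_nper hK).
have -> : \sum_(l : {ffun 'I_(a + b) -> 'I_n}) nperd K (Lab (gunion G1 G2) l) x =
    \sum_(l1 : {ffun 'I_a -> 'I_n}) \sum_(l2 : {ffun 'I_b ->
      'I_n}) nperd K (ncat (Lab G1 l1) (Lab G2 l2)) x.
  rewrite pair_bigA (reindex (@labcat a b n)) /=; last exact/onW_bij/labcat_bij.
  apply: eq_bigr => p _; rewrite nperd_equiv (equiv_eqr (Lab_gunion _ v1 v2)) -nperd_equiv.
  by rewrite labcatL labcatR.
under eq_bigr do under eq_bigr do rewrite nperd_ncat.
under eq_bigr do rewrite exchange_big /=.
rewrite exchange_big big_distrl /=; apply: eq_bigr => A _.
under eq_bigr do rewrite exchange_big /=.
rewrite exchange_big big_distrl /=; apply: eq_bigr => B _.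
rewrite !(PhiG_nper hK) (ngroup_mask A B).
under eq_bigr do rewrite -big_distrr /=.
rewrite -big_distrl /= !invfM; ring.
Qed.

Lemma castG_valid a b (e : a = b) (G : cgr a) : valid G -> valid (castG e G).
Proof.
case: b / e; rewrite /castG (@eq_mapG _ _ _ id) ?mapG_id // => -[i c].
by rewrite /= cast_ord_id.
Qed.

Lemma PhiG_castG a b (e : a = b) (G : cgr a) n (x : idx n) : PhiG n (castG e G) x = PhiG n G x :> K.
Proof.
case: b / e; rewrite /castG (@eq_mapG _ _ _ id) ?mapG_id // => -[i c].
by rewrite /= cast_ord_id.
Qed.

(** [prodH] gives a coefficient to every member of an isomorphism class; this collects the class
    into a single [PhiG]. *)
Lemma sum_iso_PhiG N n (G : cgr N) (x : idx n) : valid G ->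
  \sum_(H : cgr N | valid H) (if iso H G then (orb H)%:R^-1 * PhiG n H x else 0) = PhiG n G x :> K.
Proof.
move=> vG; rewrite -big_mkcondr /=.
rewrite (eq_bigr (fun=> (orb G)%:R^-1 * PhiG n G x)) => [|H /andP[vH iH]]; last first.
  by rewrite (orb_iso iH) (PhiG_iso _ _ vH iH).
rewrite big_const iter_addr_0 -[LHS]mulr_natl mulrA.
rewrite (eq_card (B := [set H | valid H && iso G H])) ?mulfV ?mul1r ?orb_neq0 // => H.
by rewrite inE iso_sym.
Qed.

Lemma tlen_ncat_mask n (x : idx n) (A : {set 'I_(size x.1)}) (B : {set 'I_(size x.2)}) :
  (tlen (mask (msk A) x.1, mask (msk B) x.2)
   + tlen (mask (msk (~: A)) x.1, mask (msk (~: B)) x.2))%N = tlen x.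
Proof.
rewrite /tlen -size_cat; apply/perm_size.
apply: perm_trans (_ : perm_eq _ (nflat (ncat (mask (msk A) x.1, mask (msk B) x.2)
   (mask (msk (~: A)) x.1, mask (msk (~: B)) x.2)))) _; first by rewrite perm_sym nflat_ncat.
rewrite /nflat /ncat /= !msk_setC; apply: perm_cat.
  by apply: perm_flatten; apply: perm_mask_negb; rewrite size_msk.
by apply: perm_mask_negb; rewrite size_msk.
Qed.

Lemma PhiHN_conv (f g : Hhat K) N n (y1 y2 : idx n) : (tlen y1 + tlen y2)./2 = N ->
  \sum_(i < N.+1) PhiHN f i y1 * PhiHN g (N - i) y2 = PhiH f n y1 * PhiH g n y2.
Proof.
move=> hN; rewrite !PhiHE.
(* For odd [tlen y1] both sides are 0; otherwise only [i = (tlen y1)./2] contributes. *)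
have [o1|e1] := boolP (odd (tlen y1)).
  have z m : PhiHN f m y1 = 0 by apply: PhiHN0; apply: contraTneq o1 => ->; rewrite odd_double.
  by rewrite big1 ?z ?mul0r // => i _; rewrite z mul0r.
have lt : ((tlen y1)./2 < N.+1)%N by lia.
rewrite (bigD1 (Ordinal lt)) //= big1 ?addr0.
  by have -> : (N - (tlen y1)./2)%N = (tlen y2)./2 by lia.
move=> i hi; rewrite PhiHN0 ?mul0r //; apply: contra hi => /eqP e.
by apply/eqP/val_inj => /=; lia.
Qed.

Lemma PhiH_prod (f g : Hhat K) n (x : idx n) :
  PhiH (prodH f g) n x = prodL (PhiH f) (PhiH g) n x.
Proof.
rewrite PhiHE; set N := (tlen x)./2.
(* Summing out the graph [H] on which [prodH] is evaluated leaves [PhiG] of the disjoint union. *)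
transitivity (\sum_(i < N.+1) \sum_(G1 : cgr i | valid G1) \sum_(G2 : cgr (N - i) | valid G2)
    f i G1 / (orb G1)%:R * (g (N - i)%N G2 / (orb G2)%:R) * PhiG n (gunion G1 G2) x).
  rewrite /PhiHN /prodH.
  under eq_bigr do rewrite !big_distrl /=.
  rewrite exchange_big /=; apply: eq_bigr => i _.
  under eq_bigr do rewrite !big_distrl /=.
  rewrite exchange_big /=; apply: eq_bigr => G1 v1.
  under eq_bigr do rewrite !big_distrl /=.
  rewrite exchange_big /=; apply: eq_bigr => G2 v2.
  have v12 := castG_valid (ord_split i) (gunion_valid v1 v2).
  rewrite -(PhiG_castG (ord_split i)) -(sum_iso_PhiG _ v12) big_distrr /=; apply: eq_bigr => H _.
  by case: ifP => _; rewrite ?mul0r ?mulr0 // invfM; ring.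
rewrite /prodL.
under eq_bigr => i _ do under eq_bigr => G1 v1 do under eq_bigr => G2 v2 do
  rewrite PhiG_gunion // big_distrr /=.
under eq_bigr => i _ do under eq_bigr => G1 v1 do rewrite exchange_big /=.
under eq_bigr => i _ do rewrite exchange_big /=.
rewrite exchange_big /=; apply: eq_bigr => A _.
under eq_bigr => i _ do under eq_bigr => G1 v1 do under eq_bigr => G2 v2 do rewrite big_distrr /=.
under eq_bigr => i _ do under eq_bigr => G1 v1 do rewrite exchange_big /=.
under eq_bigr => i _ do rewrite exchange_big /=.
rewrite exchange_big /=; apply: eq_bigr => B _.
rewrite -[RHS]mulrA -(@PhiHN_conv f g N) ?tlen_ncat_mask // big_distrr /=.
apply: eq_bigr => i _; rewrite /PhiHN big_distrl big_distrr /=; apply: eq_bigr => G1 _.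
rewrite big_distrr big_distrr /=; apply: eq_bigr => G2 _; ring.
Qed.

End Product.

(** * Coproduct *)

Section Hyperoctahedral.
Variable N : nat.

Lemma hyp_inj (p : {perm 'I_N}) (e : {ffun 'I_N -> bool}) :
  injective (fun h : HE N => (p h.1, h.2 (+) e h.1)).
Proof. by move=> [i c] [j d] /= [/perm_inj -> /addIb ->]. Qed.

(** An element of the hyperoctahedral group: [q.1] permutes the edges and [q.2] says which of them
    are flipped. *)
Definition hyp (q : {perm 'I_N} * {ffun 'I_N -> bool}) : {perm HE N} := perm (@hyp_inj q.1 q.2).

Lemma hypE q h : hyp q h = (q.1 h.1, h.2 (+) q.2 h.1).
Proof. by rewrite permE. Qed.

Lemma hypI : injective hyp.
Proof.
move=> [p e] [p' e'] /permP h; congr (_, _).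
  by apply/permP => i; have := h (i, false); rewrite !hypE => -[].
by apply/ffunP => i; have := h (i, false); rewrite !hypE => -[].
Qed.

Lemma hyp_edgepres q : edgepres (hyp q).
Proof. by apply/edgepresP; exists q.1 => h; rewrite hypE. Qed.

Lemma card_edgepres : #|[set s : {perm HE N} | edgepres s]| = (N`! * 2 ^ N)%N.
Proof.
transitivity #|[set hyp q | q : {perm 'I_N} * {ffun 'I_N -> bool}]|; last first.
  by rewrite card_imset ?card_prod ?card_ffun ?card_bool ?card_ord ?card_Sn //; exact: hypI.
apply: eq_card => s; rewrite inE; apply/idP/imsetP => [/edgepresP[p hp]|[q _ ->]];
  last exact: hyp_edgepres.
exists (p, [ffun e => (s (e, false)).2]) => //; apply/permP => -[e b]; rewrite hypE /= ffunE.
rewrite [LHS]surjective_pairing hp; congr (_, _); case: b => //=.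
have : ((s (e, true)).1, (s (e, true)).2) != ((s (e, false)).1, (s (e, false)).2).
  by rewrite -!surjective_pairing (inj_eq perm_inj) xpair_eqE andbF.
rewrite !hp xpair_eqE eqxx /=.
by case: (s (e, true)).2; case: (s (e, false)).2.
Qed.

(** The edge-preserving permutations are sorted by the graph to which they send [G]. Each fibre is a
    translate of the automorphism group. *)
Lemma orbM_aut (G : cgr N) : valid G -> (orb G * aut G)%N = (N`! * 2 ^ N)%N.
Proof.
move=> vG; rewrite -card_edgepres -[RHS]sum1_card.
rewrite (partition_big (fun s : {perm HE N} => mapG s G) (fun H => valid H && iso G H)) /=;
  last first.
  move=> s; rewrite inE => es; have h : iso G (mapG s G) by apply/existsP; exists s;
    rewrite isobyE es eqxx.
  by rewrite h andbT (iso_valid h).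
rewrite (eq_bigr (fun=> aut G)).
  by rewrite big_const iter_addn_0 mulnC; congr (_ * _)%N; apply: eq_card => H; rewrite inE.
move=> H /andP[vH /existsP[t ht]]; rewrite sum1_card /aut.
rewrite -[RHS](card_imset _ (mulIg t)); apply: eq_card => s; rewrite [LHS]unfold_in /= inE -isobyE.
apply/idP/imsetP => [hs|[u + ->]].
  exists (s * t^-1)%g; last by rewrite mulgKV.
  by rewrite inE; apply: isobyM hs (isobyV ht).
by rewrite inE => hu; apply: isobyM hu ht.
Qed.

End Hyperoctahedral.

Lemma nmap_image (A B : eqType) (f : A -> B) (z : seq (seq B) * seq B) :
  {in nflat z, forall h, exists k, h = f k} -> exists z0, z = nmap f z0.
Proof.
have im (s : seq B) : {in s, forall h, exists k, h = f k} -> exists s0, s = map f s0.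
  elim: s => [|h s IH] hs; first by exists [::].
  have [k ->] := hs h (mem_head _ _).
  have [|s0 ->] := IH; first by move=> u hu; apply: hs; rewrite inE hu orbT.
  by exists (k :: s0).
case: z => Y t hz.
have [t0 ->] : exists t0, t = map f t0 by apply: im => h hh; apply: hz; rewrite mem_cat hh orbT.
have [Y0 ->] : exists Y0, Y = map (map f) Y0.
  have : {in flatten Y, forall h, exists k, h = f k} by move=> h hh; apply: hz; rewrite mem_cat hh.
  elim: Y {hz} => [|s Y IH] hs; first by exists [::].
  have [s0 ->] : exists s0, s = map f s0 by apply: im => h hh; apply: hs; rewrite mem_cat hh.
  have [|Y0 ->] := IH; first by move=> u hu; apply: hs; rewrite mem_cat hu orbT.
  by exists (s0 :: Y0).
by exists (Y0, t0).
Qed.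

(** Pulls the vertices back along an embedding; with [resR] it inverts [gunion] on valid graphs.
    Nonemptiness of vertices matters, since the empty set is an image under both embeddings. *)
Definition resL a b (U : cgr (a + b)) : cgr a :=
  ([set B : {set HE a} | @heL a b @: B \in U.1], [set B : {set HE a} | @heL a b @: B \in U.2]).
Definition resR a b (U : cgr (a + b)) : cgr b :=
  ([set B : {set HE b} | @heR a b @: B \in U.1], [set B : {set HE b} | @heR a b @: B \in U.2]).

Lemma valid_set0 N (G : cgr N) : valid G -> (set0 \notin G.1) && (set0 \notin G.2).
Proof.
move=> /and3P[/and3P[_ _ h] /subsetP s _]; rewrite h /=; by apply: contra h; apply: s.
Qed.

Lemma heLR a b (B : {set HE a}) (C : {set HE b}) : @heL a b @: B = @heR a b @: C ->
  C = set0 /\ B = set0.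
Proof.
have ne h k : @heL a b h <> @heR a b k by move=> /(congr1 fst) /= /eqP; rewrite eq_lrshift.
move=> /setP e; split; apply/setP => h; rewrite inE; apply/negbTE/negP => hh.
  by have := e (heR a h); rewrite imset_f // => /imsetP[k _ /esym/ne].
by have := e (heL b h); rewrite imset_f // => /esym/imsetP[k _ /ne].
Qed.

Lemma res_gunion a b (G1 : cgr a) (G2 : cgr b) : valid G1 -> valid G2 ->
  resL (gunion G1 G2) = G1 /\ resR (gunion G1 G2) = G2.
Proof.
move=> /valid_set0/andP[a1 a2] /valid_set0/andP[b1 b2].
have hl (S : {set {set HE a}}) (T : {set {set HE b}}) : set0 \notin T ->
   [set B : {set HE a} | @heL a b @: B \in [set @heL a b @: C | C : {set HE a} in S]
      :|: [set @heR a b @: C | C : {set HE b} in T]] = S.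
  move=> nT; apply/setP => B; rewrite !inE (mem_imset _ _ (imset_inj (@heL_inj a b))).
  case hB: (B \in S) => //=; apply/negbTE/imsetP => -[C hC /heLR[e _]].
  by case/negP: nT; rewrite -e.
have hr (S : {set {set HE a}}) (T : {set {set HE b}}) : set0 \notin S ->
   [set B : {set HE b} | @heR a b @: B \in [set @heL a b @: C | C : {set HE a} in S]
      :|: [set @heR a b @: C | C : {set HE b} in T]] = T.
  move=> nS; apply/setP => B; rewrite !inE orbC (mem_imset _ _ (imset_inj (@heR_inj a b))).
  case hB: (B \in T) => //=; apply/negbTE/imsetP => -[C hC /esym/heLR[_ e]].
  by case/negP: nS; rewrite -e.
by split; rewrite /resL /resR /gunion /= ?hl ?hr //; [case: (G1)|case: (G2)].
Qed.

(** * Words whose letters fall into two disjoint ranges *)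

Section Juxtapose.
Variables m n : nat.

Definition jux (x1 : idx m) (x2 : idx n) : idx (m + n) :=
  ncat (nmap (@lshift m n) x1) (nmap (@rshift m n) x2).

Definition lab2 a b (l1 : {ffun 'I_a -> 'I_m}) (l2 : {ffun 'I_b -> 'I_n}) : {ffun 'I_(a + b) ->
  'I_(m + n)} :=
  labcat ([ffun e => lshift n (l1 e)], [ffun e => rshift m (l2 e)]).

Lemma lab2L a b l1 l2 (e : 'I_a) : @lab2 a b l1 l2 (lshift b e) = lshift n (l1 e).
Proof. by have /ffunP /(_ e) := labcatL ([ffun e => lshift n (l1 e)],
  [ffun e => rshift m (l2 e)]); rewrite !ffunE. Qed.

Lemma lab2R a b l1 l2 (e : 'I_b) : @lab2 a b l1 l2 (rshift a e) = rshift m (l2 e).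
Proof. by have /ffunP /(_ e) := labcatR ([ffun e => lshift n (l1 e)],
  [ffun e => rshift m (l2 e)]); rewrite !ffunE. Qed.

(** No vertex of a juxtaposed word mixes the two ranges of letters, and [lab2] ties the ranges to
    the two sets of edges, so no vertex meets both. *)
Lemma gunion_surj a b (G : cgr (a + b)) l1 l2 x1 x2 : valid G ->
  equiv (Lab G (@lab2 a b l1 l2)) (jux x1 x2) ->
  exists G1 G2, [/\ valid G1, valid G2 & G = gunion G1 G2].
Proof.
move=> /valid_lgr[z0 hz0 ->] h.
pose la (h : HE (a + b)) := lab2 l1 l2 h.1.
have {h} : equiv (nmap id (jux x1 x2)) (nmap la z0).
  by rewrite nmap_id equiv_sym; apply: equiv_trans h; rewrite equiv_sym Lab_lgr.
case/equiv_rearrange/(_ hz0) => z [hz <- e] {z0 hz0}; rewrite nmap_id in e.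
(* After rearrangement the listing spells the word exactly, so cutting it where the word is cut
   separates the components. *)
pose z1 := (take (size x1.1) z.1, take (size x1.2) z.2).
pose z2 := (drop (size x1.1) z.1, drop (size x1.2) z.2).
have ez : z = ncat z1 z2 by rewrite /ncat /= !cat_take_drop; case: (z).
have e1 : nmap la z1 = nmap (@lshift m n) x1.
  case: e => e e'; rewrite /nmap /= !map_take -e -e' !take_size_cat ?size_map //.
have e2 : nmap la z2 = nmap (@rshift m n) x2.
  case: e => e e'; rewrite /nmap /= !map_drop -e -e' !drop_size_cat ?size_map //.
have [w1 ew1] : exists w1, z1 = nmap (@heL a b) w1.
  apply: nmap_image => -[i c] hi;
    have : la (i, c) \in nflat (nmap la z1) by rewrite nflat_nmap map_f.
  rewrite e1 nflat_nmap => /mapP[j _]; rewrite /la /=.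
  case: (split_ordP i) => k ->; first by exists (k, c).
  by rewrite lab2R => /eqP; rewrite eq_rlshift.
have [w2 ew2] : exists w2, z2 = nmap (@heR a b) w2.
  apply: nmap_image => -[i c] hi;
    have : la (i, c) \in nflat (nmap la z2) by rewrite nflat_nmap map_f.
  rewrite e2 nflat_nmap => /mapP[j _]; rewrite /la /=.
  case: (split_ordP i) => k ->; last by exists (k, c).
  by rewrite lab2L => /eqP; rewrite eq_lrshift.
rewrite ew1 ew2 in ez.
have nz : [::] \notin (nmap (@heL a b) w1).1 ++ (nmap (@heR a b) w2).1 by case/andP: hz; rewrite ez.
move: nz; rewrite mem_cat negb_or => /andP[n1 n2].
have pz := nflat_ncat (nmap (@heL a b) w1) (nmap (@heR a b) w2); rewrite -ez in pz.
have uz := listing_uniq hz; rewrite (perm_uniq pz) !nflat_nmap cat_uniq in uz.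
rewrite (map_inj_uniq (@heL_inj a b)) (map_inj_uniq (@heR_inj a b)) in uz;
  case/and3P: uz => u1 _ u2.
have ne h k : @heL a b h <> @heR a b k by move=> /(congr1 fst) /= /eqP; rewrite eq_lrshift.
have lw1 : listing w1.
  apply/andP; split; first by apply: contra n1 => h; apply/mapP; exists [::].
  apply: uniq_perm => [||h]; rewrite ?enum_uniq // mem_enum.
  have := listing_mem (heL b h) hz;
    rewrite (perm_mem pz) !nflat_nmap mem_cat (mem_map (@heL_inj a b)).
  by case/orP => // /mapP[k _ /ne].
have lw2 : listing w2.
  apply/andP; split; first by apply: contra n2 => h; apply/mapP; exists [::].
  apply: uniq_perm => [||h]; rewrite ?enum_uniq // mem_enum.
  have := listing_mem (heR a h) hz;
    rewrite (perm_mem pz) !nflat_nmap mem_cat (mem_map (@heR_inj a b)).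
  by case/orP => // /mapP[k _ /esym/ne].
exists (lgr w1), (lgr w2); split; try exact: lgr_valid.
by rewrite gunion_lgr -ez.
Qed.

Lemma Lab_lab2 a b (G1 : cgr a) (G2 : cgr b) l1 l2 : valid G1 -> valid G2 ->
  equiv (Lab (gunion G1 G2) (lab2 l1 l2)) (jux (Lab G1 l1) (Lab G2 l2)).
Proof.
move=> v1 v2; apply: equiv_trans (Lab_gunion _ v1 v2) _; rewrite /lab2 labcatL labcatR /=.
rewrite Lab_comp (Lab_comp G2) /jux (Lab_comp G1 l1) (Lab_comp G2 l2) !nmap_comp.
rewrite (@eq_nmap _ _ _ (@lshift m n \o l1)); last by move=> e; rewrite /= ffunE.
rewrite (@eq_nmap _ _ [ffun e => rshift m (l2 e)] (@rshift m n \o l2)); last by move=> e;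
  rewrite /= ffunE.
exact: equiv_refl.
Qed.

Definition lowers N (l : {ffun 'I_N -> 'I_(m + n)}) : {set 'I_N} := [set e | (l e < m)%N].

Lemma count_Lab N p (G : cgr N) (l : {ffun 'I_N -> 'I_p}) (q : pred 'I_p) : valid G ->
  count q (nflat (Lab G l)) = #|[set e | q (l e)]|.*2.
Proof.
move=> /valid_lgr[z hz ->].
rewrite (seq.permP (equiv_flat (Lab_lgr l hz))) -/(nflat _) nflat_nmap count_map.
case/andP: hz => _ /seq.permP ->; rewrite -sum1_count big_enum_cond /=.
transitivity (\sum_(e < N | q (l e)) \sum_(b : bool) 1)%N.
  by rewrite pair_big; apply: eq_bigl => h; rewrite /= andbT.
by rewrite sum_nat_const -muln2 big_const card_bool; congr (_ * _)%N; apply: eq_card => e;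
  rewrite inE.
Qed.

Lemma lowers_card N (G : cgr N) (l : {ffun 'I_N ->
  'I_(m + n)}) (x1 : idx m) (x2 : idx n) : valid G ->
  equiv (Lab G l) (jux x1 x2) -> tlen x1 = #|lowers l|.*2 /\ tlen x2 = (N - #|lowers l|).*2.
Proof.
move=> vG h.
have h1 : tlen x1 = #|lowers l|.*2.
  rewrite -(count_Lab l (fun i => i < m)%N vG) (seq.permP (equiv_flat h)) -/(nflat (jux _ _)).
  rewrite (seq.permP (nflat_ncat _ _)) count_cat !nflat_nmap !count_map.
  rewrite (eq_count (a2 := predT)) => [|i]; last by rewrite /= ltn_ord.
  rewrite count_predT (eq_count (a2 := pred0)) => [|i]; first by rewrite count_pred0 addn0.
  by rewrite /= ltnNge leq_addr.
split=> //; have := equiv_tlen h; rewrite tlen_Lab // [tlen (jux _ _)](perm_size (nflat_ncat _ _)).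
by rewrite size_cat !nflat_nmap !size_map -/(tlen x1) -/(tlen x2) h1; lia.
Qed.

End Juxtapose.

Lemma perm_cat_split (T : eqType) (q : pred T) (A B C D : seq T) :
  all q A -> all q C -> all (predC q) B -> all (predC q) D ->
  perm_eq (A ++ B) (C ++ D) -> perm_eq A C && perm_eq B D.
Proof.
have f0 (a : pred T) s : all (predC a) s -> filter a s = [::].
  by rewrite all_predC has_filter negbK => /eqP.
move=> hA hC hB hD h; apply/andP; split.
  by have := perm_filter q h; rewrite !filter_cat (all_filterP hA) (all_filterP hC) !f0 // !cats0.
have nn s : all q s -> all (predC (predC q)) s by apply: sub_all => a /=; rewrite negbK.
have := perm_filter (predC q) h; rewrite !filter_cat (all_filterP hB) (all_filterP hD).
by rewrite (f0 _ A) ?(f0 _ C) //; apply: nn.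
Qed.

Section Coproduct.
Variable K : fieldType.
Hypothesis hK : [pchar K] =i pred0.

Section Fixed.
Variables (m n : nat) (x1 : idx m) (x2 : idx n).
Hypotheses (nx1 : [::] \notin x1.1) (nx2 : [::] \notin x2.1).

(** The range of its letters tells on which side a block lies. An empty block would fit either side,
    hence the nonemptiness conditions. *)
Lemma equiv_jux (y1 : idx m) (y2 : idx n) : [::] \notin y1.1 -> [::] \notin y2.1 ->
  equiv (jux y1 y2) (jux x1 x2) = equiv y1 x1 && equiv y2 x2.
Proof.
move=> ny1 ny2; apply/idP/andP => [|[h1 h2]]; last by apply: equiv_ncat; apply: equiv_nmap.
rewrite -(equiv_nmap_inj hK _ _ (@lshift_inj m n)) -(equiv_nmap_inj hK _ _ (@rshift_inj m n)).
case/andP; rewrite /jux /ncat /= !map_cat.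
have aL (s : seq 'I_m) : all (fun i : 'I_(m + n) => (i < m)%N) (map (@lshift m n) s).
  by apply/allP => i /mapP[j _ ->] /=.
have aR (s : seq 'I_n) : all (predC (fun i : 'I_(m + n) => (i < m)%N)) (map (@rshift m n) s).
  by apply/allP => i /mapP[j _ ->] /=; rewrite -leqNgt leq_addr.
have kL (X : seq (seq 'I_m)) : all (fun k => all (fun i => (i < m)%N) k) (map (@key _) (map (map
  (@lshift m n)) X)).
  apply/allP => k /mapP[s /mapP[t _ ->] ->]; rewrite all_sort all_map.
  exact: aL.
have kR (X : seq (seq 'I_n)) : [::] \notin X ->
    all (predC (fun k => all (fun i => (i < m)%N) k)) (map (@key _) (map (map (@rshift m n)) X)).
  move=> nX; apply/allP => k /mapP[s /mapP[t ht ->] ->]; rewrite /= all_sort.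
  case: t ht => [|i t] ht; first by rewrite ht in nX.
  by rewrite /= ltnNge leq_addr.
case/(perm_cat_split (aL _) (aL _) (aR _) (aR _))/andP => p1 p2.
case/(perm_cat_split (kL _) (kL _) (kR _ ny2) (kR _ nx2))/andP => p3 p4.
by rewrite /equiv p1 p2 p3 p4.
Qed.

(** Disjoint letters make the stabiliser a product, while the group grows by the two binomials,
    which are those of [deltaL]. *)
Lemma orbsize_jux : (orbsize (jux x1 x2))%:R =
  'C(size x1.1 + size x2.1, size x1.1)%:R * 'C(size x1.2 + size x2.2, size x1.2)%:R
  * ((orbsize x1)%:R * (orbsize x2)%:R) :> K.
Proof.
have nJ : nperd K (jux x1 x2) (jux x1 x2) = nperd K x1 x1 * nperd K x2 x2.
  rewrite -(nperd_nmap K x1 x1 (@lshift_inj m n)) -(nperd_nmap K x2 x2 (@rshift_inj m n)).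
  rewrite /nperd /nper /jux /ncat /= !per_block ?size_map //; first by rewrite mulrACA.
    move=> i j /mapP[i' _ ->] /mapP[j' _ ->].
    by rewrite /kdelta eq_lrshift.
  move=> s t /mapP[u hu ->] /mapP[v _ ->]; apply: kdelta_per0.
  case: u hu => [|i u] hu; first by case/negP: nx1.
  apply/negP => /perm_mem /(_ (lshift n i)); rewrite /= mem_head => /esym/mapP[j _ /eqP].
  by rewrite eq_lrshift.
have h : nperd K x1 x1 * nperd K x2 x2 != 0 by rewrite mulf_neq0 ?nperd_neq0 ?equiv_refl.
apply: (mulIf h); rewrite -{1}nJ orbsize_nperd -[RHS]mulrA [X in _ = _ * X]mulrACA !orbsize_nperd.
rewrite /ngroup /jux /ncat /= big_cat /= !big_map !size_cat !size_map.
have fb p q : ((p + q)`!)%:R = 'C(p + q, p)%:R * p`!%:R * q`!%:R :> K.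
  by rewrite -!natrM -mulnA -(bin_fact (leq_addr q p)) addKn.
rewrite !fb; under eq_bigr do rewrite size_map.
under [X in _ * (_ * X) * _ = _]eq_bigr do rewrite size_map.
ring.
Qed.

Variables (f : Hhat K) (fH : Hinv f).
Arguments f : clear implicits.

Definition wt N (G : cgr N) : K := f N G / (orb G)%:R.

Definition labsum N (l : {ffun 'I_N -> 'I_(m + n)}) : K :=
  \sum_(G : cgr N | valid G) wt G * (equiv (Lab G l) (jux x1 x2))%:R.

(** Permuting the edges under a labelling amounts to an isomorphism of the graphs summed over, and
    [f] is invariant. *)
Lemma labsum_perm N (p : {perm 'I_N}) (l : {ffun 'I_N -> 'I_(m + n)}) :
  labsum [ffun e => l (p e)] = labsum l.
Proof.
pose s := hyp (p, [ffun=> false]).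
have isG G : iso G (mapG s G) by apply/existsP; exists s; rewrite isobyE hyp_edgepres eqxx.
rewrite /labsum [RHS](reindex (mapG s)) /=; last first.
  exists (mapG s^-1%g) => G _; rewrite mapG_comp (@eq_mapG _ _ _ id) ?mapG_id // => h /=.
    by rewrite permK.
  by rewrite permKV.
apply: eq_big => G.
  by apply/idP/idP; apply: iso_valid; rewrite // iso_sym.
move=> vG; rewrite /wt (fH vG (isG G)) (orb_iso (isG G)) -(equiv_eqr (Lab_iso (s := s) (p :=
  p) l vG _)) //.
by move=> h; rewrite hypE.
Qed.

Lemma labsum0 N (l : {ffun 'I_N -> 'I_(m + n)}) :
  tlen x1 != #|lowers l|.*2 -> labsum l = 0.
Proof.
move=> h; rewrite /labsum big1 // => G vG; case e: equiv; rewrite ?mulr0 //.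
by case/negP: h; rewrite (lowers_card vG e).1 eqxx.
Qed.

(** Exactly [a] edges carry letters of the first range. By [labsum_perm] every choice of these edges
    gives the same sum, so they may be taken to be the first [a]. *)
Lemma sum_labsum a b : tlen x1 = a.*2 ->
  \sum_(l : {ffun 'I_(a + b) -> 'I_(m + n)}) labsum l = 'C(a + b, a)%:R *
  \sum_(l : {ffun 'I_(a + b) -> 'I_(m + n)} | lowers l == [set lshift b i | i : 'I_a]) labsum l.
Proof.
move=> ha; set A0 := [set lshift b i | i : 'I_a].
have cA0 : #|A0| = a by rewrite card_imset ?card_ord //; apply: lshift_inj.
rewrite (bigID (fun l => #|lowers l| == a)) /= [X in _ + X]big1 ?addr0; last first.
  by move=> l hl; apply: labsum0; rewrite ha; apply: contra hl => /eqP/double_inj <-.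
rewrite (partition_big (@lowers m n (a + b)) (fun A => #|A| == a)) //=.
rewrite (eq_bigr (fun=> \sum_(l : {ffun 'I_(a + b) -> 'I_(m + n)} | lowers l == A0) labsum l)).
  rewrite big_const iter_addr_0 -[LHS]mulr_natl; congr (_%:R * _).
  rewrite -[X in 'C(X, _)](card_ord (a + b)) -card_draws.
  by apply: eq_card => A; rewrite inE.
move=> A /eqP cA.
(* An edge permutation that carries the standard set [A0] to [A]. *)
have [p hp] : exists p : {perm 'I_(a + b)}, forall e, (p e \in A) = (e \in A0).
  have en (B : {set 'I_(a + b)}) : perm_eq (enum B ++ enum (~: B)) (enum 'I_(a + b)).
    apply: uniq_perm => [||e]; rewrite ?enum_uniq //.
      rewrite cat_uniq !enum_uniq andbT; apply/hasPn => e; rewrite !mem_enum inE //.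
    by rewrite mem_cat !mem_enum inE orbN.
  have [p ep] := perm_from_lists (en A0) (en A); exists p => e.
  have eA : map p (enum A0) = enum A.
    move/(congr1 (take (size (enum A)))): ep; rewrite take_size_cat // map_cat take_size_cat //.
    by rewrite size_map -!cardE cA cA0.
  by rewrite -mem_enum -eA (mem_map perm_inj) mem_enum.
rewrite [RHS](reindex (fun l : {ffun 'I_(a + b) -> 'I_(m + n)} => [ffun e => l (p e)])) /=;
  last first.
  exists (fun l : {ffun 'I_(a + b) -> 'I_(m + n)} => [ffun e => l (p^-1%g e)]) => l _;
    apply/ffunP => e; rewrite !ffunE.
    by rewrite permKV.
  by rewrite permK.
apply: eq_big => [l|l _]; last by rewrite labsum_perm.
have -> : (#|lowers l| == a) && (lowers l == A) = (lowers l == A).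
  by case: (lowers l =P A) => [->|]; rewrite ?cA ?eqxx ?andbF.
apply/eqP/eqP => e; apply/setP => i.
  by rewrite !inE ffunE -hp -e inE.
by rewrite -{1 2}(permKV p i) hp -e !inE ffunE.
Qed.

Lemma sum_lab2 a b (F : {ffun 'I_(a + b) -> 'I_(m + n)} -> K) :
  \sum_(l : {ffun 'I_(a + b) -> 'I_(m + n)} | lowers l == [set lshift b i | i : 'I_a]) F l =
  \sum_(l1 : {ffun 'I_a -> 'I_m}) \sum_(l2 : {ffun 'I_b -> 'I_n}) F (lab2 l1 l2).
Proof.
rewrite big_mkcond pair_bigA /=.
have lowE (l1 : {ffun 'I_a -> 'I_m}) (l2 : {ffun 'I_b -> 'I_n}) :
    lowers (lab2 l1 l2) = [set lshift b i | i : 'I_a].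
  apply/setP => e; rewrite inE; case: (split_ordP e) => i ->.
    by rewrite lab2L /= ltn_ord imset_f.
  rewrite lab2R /= ltnNge leq_addr; apply/esym/negbTE/imsetP => -[j _ /eqP].
  by rewrite eq_rlshift.
rewrite (@big_inj_support _ _ _ (fun p : {ffun 'I_a -> 'I_m} * {ffun 'I_b ->
  'I_n} => lab2 p.1 p.2)).
- by apply: eq_bigr => p _; rewrite lowE eqxx.
- move=> [l1 l2] [k1 k2] /ffunP /= h; congr (_, _); apply/ffunP => e.
    by apply: (@lshift_inj m n); have := h (lshift b e); rewrite !lab2L.
  by apply: (@rshift_inj m n); have := h (rshift a e); rewrite !lab2R.
move=> l; case: ifP => [/eqP/setP hl _|]; last by rewrite eqxx.
have h1 e : exists c, l (lshift b e) == lshift n c.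
  have := hl (lshift b e); rewrite inE imset_f //.
  by case: (split_ordP (l (lshift b e))) => i -> // _; exists i.
have h2 e : exists c, l (rshift a e) == rshift m c.
  have := hl (rshift a e); rewrite inE.
  have -> : (rshift a e \in [set lshift b i | i : 'I_a]) = false.
    by apply/negbTE/imsetP => -[j _ /eqP]; rewrite eq_rlshift.
  by case: (split_ordP (l (rshift a e))) => i -> // _; exists i.
exists ([ffun e => xchoose (h1 e)], [ffun e => xchoose (h2 e)]); apply/ffunP => e /=.
case: (split_ordP e) => i ->; rewrite ?lab2L ?lab2R ffunE; apply/eqP.
  exact: (xchooseP (h1 i)).
exact: (xchooseP (h2 i)).
Qed.

(** By [gunion_surj] only disjoint unions contribute, and [equiv_jux] splits their matching
    condition. *)
Lemma labsum_lab2 a b l1 l2 : labsum (@lab2 m n a b l1 l2) =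
  \sum_(G1 : cgr a | valid G1) \sum_(G2 : cgr b | valid G2)
    wt (gunion G1 G2) * (equiv (Lab G1 l1) x1)%:R * (equiv (Lab G2 l2) x2)%:R.
Proof.
pose P (G : cgr (a + b)) := valid G && equiv (Lab G (lab2 l1 l2)) (jux x1 x2).
transitivity (\sum_(G | P G) wt G).
  rewrite /labsum /P [RHS]big_mkcondr; apply: eq_bigr => G _.
  by case: ifP; rewrite ?mulr1 ?mulr0.
transitivity (\sum_(p : cgr a * cgr b | [&& valid p.1, valid p.2,
  equiv (Lab p.1 l1) x1 & equiv (Lab p.2 l2) x2])
   wt (gunion p.1 p.2)); last first.
  rewrite pair_big big_mkcond [RHS]big_mkcond; apply: eq_bigr => -[G1 G2] _ /=.
  by do 2 (case: valid => //=); case: equiv; rewrite /= ?mulr0 ?mul0r //; case: equiv;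
    rewrite ?mulr1 ?mulr0.
(* The restrictions invert [gunion] only on contributing graphs, which is all that [reindex_onto]
   asks. *)
rewrite (reindex_onto (fun p : cgr a * cgr b => gunion p.1 p.2) (fun G => (resL G, resR G))) /=;
  last first.
  move=> G /andP[vG /(gunion_surj vG)[G1 [G2 [v1 v2 ->]]]].
  by have [-> ->] := res_gunion v1 v2.
apply: eq_bigl => -[G1 G2] /=; apply/andP/and4P => [[/andP[vG e]]|[v1 v2 e1 e2]].
  have [H1 [H2 [w1 w2 eG]]] := gunion_surj vG e.
  rewrite eG; have [-> ->] := res_gunion w1 w2 => /eqP[e1 e2]; subst H1 H2.
  have : equiv (jux (Lab G1 l1) (Lab G2 l2)) (jux x1 x2).
    by rewrite -(equiv_eqr (Lab_lab2 _ _ w1 w2)).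
  by rewrite equiv_jux ?nil_Lab // => /andP[].
split; last by have [-> ->] := res_gunion v1 v2; rewrite eqxx.
by rewrite /P gunion_valid //= (equiv_eqr (Lab_lab2 _ _ v1 v2)) equiv_jux ?nil_Lab ?e1.
Qed.

(** The binomials in the slots cancel against [orbsize_jux]; the one that remains counts the choices
    of edges for the first factor. *)
Lemma PhiH_jux a b : tlen x1 = a.*2 -> tlen x2 = b.*2 ->
  'C(size x1.1 + size x2.1, size x1.1)%:R * 'C(size x1.2 + size x2.2, size x1.2)%:R
    * PhiH f (m + n) (jux x1 x2) =
  \sum_(G1 : cgr a | valid G1) \sum_(G2 : cgr b | valid G2)
    'C(a + b, a)%:R * wt (gunion G1 G2) * PhiG m G1 x1 * PhiG n G2 x2.
Proof.
move=> h1 h2; have tJ : tlen (jux x1 x2) = (a + b).*2.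
  rewrite [LHS](perm_size (nflat_ncat _ _)) size_cat !nflat_nmap !size_map.
  by rewrite -/(tlen x1) -/(tlen x2) h1 h2 doubleD.
have O p q : 'C(p + q, p)%:R != 0 :> K by apply: natr_neq0 => //; rewrite bin_gt0 leq_addr.
have -> : PhiH f (m + n) (jux x1 x2) =
    (\sum_(l : {ffun 'I_(a + b) -> 'I_(m + n)}) labsum l) / (orbsize (jux x1 x2))%:R.
  rewrite PhiHE tJ doubleK /PhiHN /labsum exchange_big big_distrl /=; apply: eq_bigr => G vG.
  by rewrite PhiG_sum -!big_distrl -big_distrr /= mulrA.
rewrite sum_labsum // sum_lab2 orbsize_jux invfM.
rewrite mulrCA [X in _ * X]mulrA mulfV ?mulf_neq0 // mul1r.
under eq_bigr do under eq_bigr do rewrite labsum_lab2.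
under eq_bigr do rewrite exchange_big /=.
rewrite exchange_big big_distrr big_distrl /=; apply: eq_bigr => G1 v1.
under eq_bigr do rewrite exchange_big /=.
rewrite exchange_big big_distrr big_distrl /=; apply: eq_bigr => G2 v2.
rewrite !PhiG_sum -!big_distrl /=.
under eq_bigr do rewrite -big_distrr /= -mulrA.
rewrite -big_distrr -big_distrl /= invfM; ring.
Qed.

End Fixed.

Lemma PhiH_coprod (f : Hhat K) : Hinv f -> forall m n (x1 : idx m) (x2 : idx n),
  deltaL (PhiH f) m n x1 x2 = PhiPhi (coprodH f) m n x1 x2.
Proof.
move=> fH m n x1 x2; rewrite /deltaL /PhiPhi -[(_ ++ _, _)]/(jux x1 x2).
(* With an empty block or an odd number of slots on either side, both sides vanish. *)
have [bad|] := boolP [|| [::] \in x1.1, [::] \in x2.1, odd (tlen x1) | odd (tlen x2)].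
  rewrite PhiHE /PhiHN !big1 ?mulr0 //.
    move=> i _; rewrite big1 // => j _; rewrite big1 // => G1 v1; rewrite big1 // => G2 v2.
    have [h|h1] := boolP ([::] \in x1.1); first by rewrite (PhiG_nil K v1 h) mulr0 mul0r.
    have [h|h2] := boolP ([::] \in x2.1); first by rewrite (PhiG_nil K v2 h) mulr0.
    move: bad; rewrite (negPf h1) (negPf h2) /= => /orP[o|o].
      by rewrite (PhiG0 K v1) ?mulr0 ?mul0r //; apply: contraTneq o => ->; rewrite odd_double.
    by rewrite (PhiG0 K v2) ?mulr0 //; apply: contraTneq o => ->; rewrite odd_double.
  move=> G vG; rewrite PhiG_sum big1 ?mulr0 // => l _; case e: equiv; rewrite ?mul0r //.
  have := nil_Lab l vG; rewrite (equiv_nil e) mem_cat negb_or => /andP[n1 n2].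
  have [t1 t2] := lowers_card vG e; case/or4P: bad.
  - by move=> h; case/negP: n1; apply/mapP; exists [::].
  - by move=> h; case/negP: n2; apply/mapP; exists [::].
  - by rewrite t1 odd_double.
  by rewrite t2 odd_double.
rewrite !negb_or => /and4P[n1 n2 o1 o2].
pose a := (tlen x1)./2; pose b := (tlen x2)./2.
have h1 : tlen x1 = a.*2 by rewrite even_halfK.
have h2 : tlen x2 = b.*2 by rewrite even_halfK.
rewrite (PhiH_jux n1 n2 fH h1 h2).
have la : (a < (tlen x1).+1)%N by rewrite h1; lia.
have lb : (b < (tlen x2).+1)%N by rewrite h2; lia.
rewrite [RHS](bigD1 (Ordinal la)) //= [X in _ = _ + X]big1 ?addr0; last first.
  move=> i hi; apply: big1 => j _; apply: big1 => G1 v1; apply: big1 => G2 v2.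
  rewrite (PhiG0 K v1) ?mulr0 ?mul0r //; apply: contra hi => /eqP e.
  by apply/eqP/val_inj; apply: double_inj; rewrite /= -e.
rewrite [RHS](bigD1 (Ordinal lb)) //= [X in _ = _ + X]big1 ?addr0; last first.
  move=> j hj; apply: big1 => G1 v1; apply: big1 => G2 v2.
  rewrite (PhiG0 K v2) ?mulr0 //; apply: contra hj => /eqP e.
  by apply/eqP/val_inj; apply: double_inj; rewrite /= -e.
apply: eq_bigr => G1 v1; apply: eq_bigr => G2 v2; congr (_ * _ * _).
(* Replacing each [aut] by [N! 2^N / orb] turns the ratio of automorphism groups in [coprodH] into
   the binomial ['C(a + b, a)] of [PhiH_jux]. *)
have E N (G : cgr N) : valid G -> (orb G)%:R * (aut G)%:R = (N`!)%:R * 2%:R ^+ N :> K.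
  by move/orbM_aut => e; rewrite -natrM e natrM natrX.
have nz N : (N`!)%:R * 2%:R ^+ N != 0 :> K.
  by rewrite mulf_neq0 ?expf_neq0 ?(natr_neq0 hK) // fact_gt0.
have vG := gunion_valid v1 v2; have o := orb_neq0 hK vG.
rewrite /wt /coprodH -mulrA -invfM mulrACA [_ * (orb G1)%:R]mulrC [_ * (orb G2)%:R]mulrC.
rewrite (E _ _ v1) (E _ _ v2).
have -> : (aut (gunion G1 G2))%:R = ((a + b)`!)%:R * 2%:R ^+ (a + b) / (orb (gunion G1 G2))%:R :> K.
  by rewrite -(E _ _ vG) mulrAC mulfV ?mul1r.
rewrite -(bin_fact (leq_addr b a)) addKn !natrM exprD.
have fa : a`!%:R != 0 :> K by rewrite (natr_neq0 hK) ?fact_gt0.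
have fb : b`!%:R != 0 :> K by rewrite (natr_neq0 hK) ?fact_gt0.
have t2 : 2%:R != 0 :> K by rewrite (natr_neq0 hK).
have ta : 2%:R ^+ a != 0 :> K by rewrite expf_neq0.
have tb : 2%:R ^+ b != 0 :> K by rewrite expf_neq0.
by field; rewrite ta tb fa fb o.
Qed.

End Coproduct.

Theorem theorem3p10 (K : fieldType) (hK : [pchar K]%R =i pred0) :
  [/\ (* Phi maps \hat H into l^infty *)
      forall f : Hhat K, Hinv f -> linf (PhiH f),
      (* injective *)
      forall f g : Hhat K, Hinv f -> Hinv g ->
        (forall n (x : idx n), PhiH f n x = PhiH g n x) ->
        forall N (G : cgr N), valid G -> f N G = g N G,
      (* surjective *)
      forall c : Lfam K, linf c ->
        exists f : Hhat K, Hinv f /\ forall n (x : idx n), PhiH f n x = c n x,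
      (* unit and product *)
      (forall n (x : idx n), PhiH (@unitH K) n x = @unitL K n x) /\
      (forall f g : Hhat K, Hinv f -> Hinv g ->
        forall n (x : idx n), PhiH (prodH f g) n x = prodL (PhiH f) (PhiH g) n x)
    & (* coproduct *)
      forall f : Hhat K, Hinv f ->
        forall m n (x1 : idx m) (x2 : idx n),
          deltaL (PhiH f) m n x1 x2 = PhiPhi (coprodH f) m n x1 x2].
Proof.
split.
- by move=> f _; apply: PhiH_linf.
- exact: PhiH_inj.
- exact: PhiH_surj.
- by split=> [n x|f g _ _ n x]; [apply: PhiH_unit | apply: PhiH_prod].
exact: PhiH_coprod.
Qed.
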